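(* Let $K$ be a perfect field, $F \mid K$ an algebraic function field in one variable, and $S \neq \emptyset$ a finite set of places of $F \mid K$. Denote by $\mathcal{O}_S$ the ring of $S$-integers of $F$. Then, for each positive integer $N$, there exists an element of $\mathcal{O}_S$ that cannot be written as a sum of at most $N$ units of $\mathcal{O}_S$. In particular, $u(\mathcal{O}_S) \geq \omega$.
   Context: An algebraic function field over a field $K$ is a finitely generated extension $F \mid K$ of transcendence degree $1$ (the field $K$ is not required to be algebraically closed in $F$). The places of $F \mid K$ are the maximal ideals $P$ of the discrete valuation rings of $F$ containing $K$; they correspond to surjective discrete valuations $v_P : F \to \mathbb{Z} \cup \{\infty\}$ of $F$ over $K$. A place $P$ is a pole of $f \in F$ if $v_P(f) < 0$. For a finite set $S$ of places of $F \mid K$, the ring $\mathcal{O}_S$ of $S$-integers of $F$ is the set of all elements of $F$ that have no poles outside of $S$. Unit sum number: let $R$ be a ring with identity and $k$ a positive integer. An element $r \in R$ is $k$-good if there are units $e_1, \ldots, e_k$ of $R$ with $r = e_1 + \cdots + e_k$. The ring $R$ is $k$-good if every element of $R$ is $k$-good. The unit sum number is $u(R) := \min\{k \mid R \text{ is } k\text{-good}\}$ if this minimum exists; if it does not exist but $R$ is additively generated by its units, then $u(R) := \omega$; if the units do not generate $R$ additively, then $u(R) := \infty$. By convention $n < \omega < \infty$ for every integer $n$. *)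

(* Defs.v *)
From HB Require Import structures.
From mathcomp Require Import all_boot all_order all_algebra all_field.
From mathcomp Require Import boolp classical_sets functions cardinality.
From mathcomp Require Import constructive_ereal.

Set Implicit Arguments.
Unset Strict Implicit.
Unset Printing Implicit Defensive.

Import Order.TTheory GRing.Theory Num.Theory.

Local Open Scope classical_set_scope.
Local Open Scope ring_scope.

Definition perfect_field (K : fieldType) : Prop :=
  forall p : {poly K}, irreducible_poly p -> separable_poly p.

(* Since x / 0 = 0 in a [fieldType], the subsets A with [divring_closed [in A]] are
   exactly the subfields of F. *)
Definition field_gen (F : fieldType) (G : set F) : set F :=
  smallest (fun A : set F => divring_closed [in A]) G.

Section FunctionField.
Context (K F : fieldType) (iota : {rmorphism K -> F}).

(* K(G) *)
Definition adjoin (G : set F) : set F := field_gen (range iota `|` G).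

Definition finitely_generated_field : Prop :=
  exists2 G : set F, finite_set G & adjoin G = setT.

Definition algebraic_over_subfield (E : set F) (x : F) : Prop :=
  exists2 p : {poly F}, p != 0 & p \is a polyOver [in E] /\ root p x.

(* A one-element set [set t] is algebraically independent over K iff t is
   transcendental over K, so this asserts that F | K has a transcendence basis
   with exactly one element. *)
Definition transcendence_degree_one : Prop :=
  exists2 t : F, ~ algebraicOver iota t &
    forall x : F, algebraic_over_subfield (adjoin [set t]) x.

Definition function_field : Prop :=
  finitely_generated_field /\ transcendence_degree_one.

End FunctionField.

(* The target Z u {oo} is the set of elements of [\bar int] other than -oo. *)
Record discrete_valuation (F : fieldType) (v : F -> \bar int) : Prop :=
  DiscreteValuation {
    dval_range : range v = [set n | n != -oo%E] ;
    dval_infty : forall x, v x = +oo%E <-> x = 0 ;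
    dvalM : forall x y, v (x * y) = (v x + v y)%E ;
    dvalD : forall x y, (Order.min (v x) (v y) <= v (x + y)%R)%E
  }.

Definition is_dvr (F : fieldType) (O : set F) : Prop :=
  exists2 v : F -> \bar int,
    discrete_valuation v & O = [set x | (0 <= v x)%E].

Definition is_ideal (F : fieldType) (O I : set F) : Prop :=
  [/\ I `<=` O, I 0, (forall x y, I x -> I y -> I (x + y)) &
      forall a x, O a -> I x -> I (a * x)].

Definition is_maximal_ideal (F : fieldType) (O P : set F) : Prop :=
  [/\ is_ideal O P, P <> O &
      forall J, is_ideal O J -> P `<=` J -> J <> O -> J = P].

Section Places.
Context (K F : fieldType) (iota : {rmorphism K -> F}).

Definition is_place (P : set F) : Prop :=
  exists O : set F, [/\ is_dvr O, range iota `<=` O & is_maximal_ideal O P].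

End Places.

(* v = v_P: the surjective discrete valuation of which P is the set of elements
   of positive value; it is uniquely determined by the place P. *)
Definition valuation_of (F : fieldType) (P : set F) (v : F -> \bar int) : Prop :=
  discrete_valuation v /\ P = [set x | (0 < v x)%E].

Definition is_pole (F : fieldType) (P : set F) (f : F) : Prop :=
  exists2 v : F -> \bar int, valuation_of P v & (v f < 0)%E.

Section SIntegers.
Context (K F : fieldType) (iota : {rmorphism K -> F}) (S : set (set F)).

Definition S_integral : set F :=
  [set f | forall P, is_place iota P -> ~ S P -> ~ is_pole P f].

Definition S_integral_pred : {pred F} := fun f => `[< S_integral f >].

Let dval1 (v : F -> \bar int) : discrete_valuation v -> v 1 = 0%E.
Proof.
move=> dv; have := dvalM dv 1 1; rewrite mulr1.
case v1: (v 1) => [n| |] //.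
- by case=> /eqP; rewrite -subr_eq0 opprD addNKr oppr_eq0 => /eqP ->.
- by have /(dval_infty dv)/eqP := v1; rewrite oner_eq0.
- have : range v (v 1) by exists 1.
  by rewrite (dval_range dv) v1.
Qed.

Let dvalN (v : F -> \bar int) : discrete_valuation v -> forall x, v (- x) = v x.
Proof.
move=> dv x; suff vN1 : v (-1) = 0%E by rewrite -mulN1r (dvalM dv) vN1 add0e.
have := dvalM dv (-1) (-1); rewrite mulrNN mulr1 (dval1 dv).
case: (v (-1)) => [n| |] // [].
by move=> /esym/eqP; rewrite -mulr2n mulrn_eq0 /= => /eqP ->.
Qed.

Lemma S_integral_subring : subring_closed S_integral_pred.
Proof.
split.
- apply/asboolP => P _ _ [v [dv _]].
  by rewrite (dval1 dv) ltxx.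
- move=> x y /asboolP xI /asboolP yI; apply/asboolP => P pP nSP [v vP].
  have [dv _] := vP; rewrite ltNge => /negP; apply.
  apply: le_trans (dvalD dv x (- y)); rewrite le_min (dvalN dv).
  rewrite !leNgt; apply/andP; split; apply/negP => ?.
    by apply: (xI P pP nSP); exists v.
  by apply: (yI P pP nSP); exists v.
- move=> x y /asboolP xI /asboolP yI; apply/asboolP => P pP nSP [v vP].
  have [dv _] := vP; rewrite ltNge => /negP; apply.
  rewrite (dvalM dv); apply: adde_ge0; rewrite leNgt; apply/negP => ?.
    by apply: (xI P pP nSP); exists v.
  by apply: (yI P pP nSP); exists v.
Qed.

HB.instance Definition _ :=
  GRing.isSubringClosed.Build F S_integral_pred S_integral_subring.

Record S_integers : predArgType := SInteger {
  S_integers_val : F ;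
  _ : S_integers_val \in S_integral_pred
}.

HB.instance Definition _ := [isSub for S_integers_val].
HB.instance Definition _ := [Choice of S_integers by <:].
HB.instance Definition _ := [SubChoice_isSubComNzRing of S_integers by <:].

Definition S_integers_unit : pred S_integers :=
  fun x => `[< exists y : S_integers, y * x = 1 >].

Definition S_integers_inv (x : S_integers) : S_integers :=
  xget x [set y | y * x = 1].

Let S_integers_mulVx : {in S_integers_unit, left_inverse 1 S_integers_inv *%R}.
Proof.
by move=> x /asboolP [y yx]; rewrite /S_integers_inv; case: xgetP => // /(_ y).
Qed.

Let S_integers_unitPl : forall x y : S_integers, y * x = 1 -> S_integers_unit x.
Proof. by move=> x y yx; apply/asboolP; exists y. Qed.

Let S_integers_inv_out :
  {in [predC S_integers_unit], S_integers_inv =1 id}.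
Proof.
move=> x /negP nux; rewrite /S_integers_inv; case: xgetP => // y _ yx.
by case: nux; apply/asboolP; exists y.
Qed.

HB.instance Definition _ := GRing.ComNzRing_hasMulInverse.Build S_integers
  S_integers_mulVx S_integers_unitPl S_integers_inv_out.

End SIntegers.

Section UnitSumNumber.
Context (R : unitRingType).

(* For k = 0 this says r = 0 (the empty sum). *)
Definition good_elt (k : nat) (r : R) : Prop :=
  exists2 e : 'I_k -> R,
    (forall i, e i \is a GRing.unit) & r = \sum_(i < k) e i.

Definition good_ring (k : nat) : Prop := forall r : R, good_elt k r.

Definition generated_by_units : Prop :=
  smallest (fun A : set R => zmod_closed [in A]) [set x | x \is a GRing.unit] = setT.

End UnitSumNumber.

Inductive usn := Fin of nat | Omega | Infty.

Definition usn_le (a b : usn) : bool :=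
  match a, b with
  | Fin m, Fin n => (m <= n)%N
  | Fin _, _ => true
  | Omega, Fin _ => false
  | Omega, _ => true
  | Infty, Infty => true
  | Infty, _ => false
  end.

Definition unit_sum_number (R : unitRingType) : usn :=
  match pselect (exists k, (0 < k)%N && `[< good_ring R k >]) with
  | left exk => Fin (ex_minn exk)
  | right _ => if `[< generated_by_units R >] then Omega else Infty
  end.

(* Main.v *)
(** Modulo constants the S-units form a finitely generated group, since a
    function without zeros and poles is algebraic over K.  Fix a nonconstant
    S-integer x, which exists by a weak form of the Riemann inequality, and
    generators g_1, ..., g_r of the S-units modulo constants.

    In characteristic p, choose q = p^N > N.  As constants are q-th powers (K is
    perfect), a sum of at most N units lies in the F^q-span of N monomials in the
    g_i with exponents in [0, q).  There are finitely many such sets of monomials,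
    so q of the elements s_l = sum_(m < q) (x^l)^(qm) x^m lie in the same span and
    are linearly dependent over F^q.  If x is not a p-th power, then
    1, x, ..., x^(q-1) are independent over F^q, and the dependence contradicts the
    Vandermonde determinant of the x^l.

    In characteristic 0, let D be a derivation of F over K with D x = x.  The
    logarithmic derivatives of units lie in the span of the D g_i / g_i, so
    D^m u / u, for m <= M, lies in a finite-dimensional K-space that does not
    depend on the unit u.  Counting dimensions yields, for any N units, a nonzero
    operator sum_(m <= M) b_m D^m with b_m in K[x] of degree < d annihilating
    them, where M and d do not depend on the units.  No such operator annihilates the
    lacunary polynomial sum_(i <= M) x^(id). *)

Require Import Defs.
From HB Require Import structures.
From mathcomp Require Import all_boot all_order all_algebra all_field.
From mathcomp Require Import boolp classical_sets functions cardinality.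
From mathcomp Require Import constructive_ereal.
From mathcomp Require Import zify ring.

Set Implicit Arguments.
Unset Strict Implicit.
Unset Printing Implicit Defensive.

Import Order.TTheory GRing.Theory Num.Theory.

Local Open Scope classical_set_scope.
Local Open Scope ring_scope.

(** What is needed about places rests on the finiteness of [F : K(t)] for transcendental t. It
    bounds chains of strict divisibility in a valuation ring containing K, so the valuation rings
    supplied by Zorn's lemma are discrete and every transcendental function has a pole. It also
    bounds the number of zeros of t. The Riemann step uses a strict form of this bound: allowing one
    more multiple of the poles of t^-1 away from a given place costs fewer than [F : K(t)]
    dimensions, whereas the products of powers of t^-1 with a basis grow at the full rate. The
    difference forces a function whose only pole is the given place. As K need not be algebraically
    closed in F, the constants are the elements of F algebraic over K: they, and not only the
    elements of K, need q-th roots in characteristic p and must be killed by D in characteristic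
    0. *)

Lemma lin_dep (R : idomainType) (I J : finType) (A : I -> J -> R) :
  (#|J| < #|I|)%N ->
  exists2 r : I -> R, (exists i, r i != 0) &
    forall j, \sum_i r i * A i j = 0.
Proof.
move=> ltJI; pose n := #|I|.
(* [A] padded by zero columns to a square matrix; the column of index #|J| is zero, so the
   determinant vanishes. *)
pose B : 'M[R]_n := \matrix_(i, k)
  if insub (k : nat) is Some k' then A (enum_val i) (enum_val (k' : 'I_#|J|)) else 0.
have /eqP/det0P[v vn0 vB] : \det B = 0.
  rewrite -det_tr (expand_det_row _ (Ordinal ltJI)) big1 // => k _.
  by rewrite !mxE insubF ?mul0r // ltnn.
exists (fun i => v 0 (enum_rank i)) => [|j].
  apply/existsP; apply: contraNT vn0; rewrite negb_exists => /forallP v0.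
  apply/eqP/rowP => k; rewrite mxE -(enum_valK k); apply/eqP.
  by have := v0 (enum_val k); rewrite negbK.
have jn : (enum_rank j < n)%N by rewrite (leq_trans _ ltJI) // ltnS ltnW // ltn_ord.
have /rowP/(_ (Ordinal jn)) := vB; rewrite !mxE => vBj.
rewrite (reindex _ (onW_bij _ (@enum_val_bij I))) /= -[RHS]vBj.
apply: eq_bigr => k _; rewrite !mxE enum_valK; congr (_ * _).
case: insubP => [u _ uj|]; last by rewrite /= ltn_ord.
by congr A; rewrite (_ : u = enum_rank j) ?enum_rankK //; apply: val_inj.
Qed.

(** * Linear dependence over the rational function field *)

Section SubfieldType.
Context (F : fieldType) (A : set F) (closedA : divring_closed [in A]).

(** The closedness proof is an argument so that the structure instances can recover it from the
    predicate. *)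
Definition subfield_pred of divring_closed [in A] : {pred F} := [in A].

HB.instance Definition _ :=
  GRing.isDivringClosed.Build F (subfield_pred closedA) closedA.

Record subfield_of : predArgType := Subfield {
  subfield_val : F;
  _ : subfield_val \in subfield_pred closedA
}.

HB.instance Definition _ := [isSub for subfield_val].
HB.instance Definition _ := [Choice of subfield_of by <:].
HB.instance Definition _ := [SubChoice_isSubIntegralDomain of subfield_of by <:].
HB.instance Definition _ := [SubIntegralDomain_isSubField of subfield_of by <:].

End SubfieldType.

Section Evaluation.
Context (K F : fieldType) (iota : {rmorphism K -> F}).

Definition ev (t : F) : {poly K} -> F := horner_eval t \o map_poly iota.

HB.instance Definition _ t :=
  GRing.RMorphism.copy (ev t) (horner_eval t \o map_poly iota).

Arguments ev : simpl never.

Lemma evE t p : ev t p = (map_poly iota p).[t]. Proof. by []. Qed.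

Lemma evC t c : ev t c%:P = iota c.
Proof. by rewrite evE map_polyC hornerC. Qed.

Lemma evX t : ev t 'X = t.
Proof. by rewrite evE map_polyX hornerX. Qed.

Lemma evXn t n : ev t 'X^n = t ^+ n.
Proof. by rewrite rmorphXn /= evX. Qed.

Definition transcendental (t : F) := ~ algebraicOver iota t.

Lemma ev_eq0 t p : transcendental t -> (ev t p == 0) = (p == 0).
Proof.
move=> tr; apply/idP/idP => [/eqP pt|/eqP->]; last by rewrite rmorph0.
by apply: contra_notT tr => pn0; exists p => //; apply/eqP.
Qed.

(** For [t] transcendental over K this is linear dependence over K(t), with denominators cleared. *)
Definition poly_dependent (t : F) (I : finType) (f : I -> F) :=
  exists2 p : I -> {poly K}, (exists i, p i != 0) & \sum_i ev t (p i) * f i = 0.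

(** For transcendental [t] this says [F : K(t)] <= n. *)
Definition rank_le (t : F) (n : nat) :=
  forall f : 'I_n.+1 -> F, poly_dependent t f.

End Evaluation.

Section Span.
Context (E F : fieldType) (phi : {rmorphism E -> F}).

Definition lin_span (I : finType) (Y : I -> F) : set F :=
  [set z | exists c : I -> E, z = \sum_i phi (c i) * Y i].

Lemma lin_span_sum (I J : finType) (Y : I -> F) (z : J -> F) :
  (forall j, lin_span Y (z j)) -> lin_span Y (\sum_j z j).
Proof.
move=> /choice[c cP]; exists (fun i => \sum_j c j i).
rewrite (eq_bigr _ (fun j _ => cP j)) exchange_big /=.
by apply: eq_bigr => i _; rewrite rmorph_sum mulr_suml.
Qed.

Lemma lin_span_scale (I : finType) (Y : I -> F) a z :
  lin_span Y z -> lin_span Y (phi a * z).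
Proof.
case=> c ->; exists (fun i => a * c i).
by rewrite mulr_sumr; apply: eq_bigr => i _; rewrite rmorphM mulrA.
Qed.

Lemma lin_span_mul (I J : finType) (Y : I -> F) (Z : J -> F) y z :
  lin_span Y y -> lin_span Z z -> lin_span (fun ij => Y ij.1 * Z ij.2) (y * z).
Proof.
case=> c -> [d ->]; exists (fun ij => c ij.1 * d ij.2).
rewrite mulr_suml -(pair_bigA _ (fun i j => phi (c i * d j) * (Y i * Z j))) /=.
apply: eq_bigr => i _; rewrite mulr_sumr; apply: eq_bigr => j _.
by rewrite rmorphM mulrACA.
Qed.

Lemma lin_span_powers g : algebraicOver phi g ->
  exists d, forall i, lin_span (fun j : 'I_d => g ^+ j) (g ^+ i).
Proof.
case=> p pn0 /rootP pg; exists (size p).-1; set d := (size p).-1.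
have szp : size p = d.+1 by rewrite prednK // size_poly_gt0.
elim=> [|i [c ci]].
  have [d0|d0] := posnP d.
    have := pg; rewrite (size1_polyC (_ : size p <= 1)%N) ?szp ?d0 //.
    rewrite map_polyC hornerC => /eqP; rewrite fmorph_eq0 => p00.
    by move: pn0; rewrite (size1_polyC (_ : size p <= 1)%N) ?szp ?d0 // polyC_eq0 p00.
  exists (fun j : 'I_d => (j == 0%N :> nat)%:R).
  rewrite (bigD1 (Ordinal d0)) //= ?eqxx mulr1n rmorph1 mul1r expr0 big1 ?addr0 // => j.
  by rewrite -val_eqE /= => /negPf->; rewrite rmorph0 mul0r.
rewrite exprSr ci mulr_suml; apply: lin_span_sum => j.
rewrite -mulrA -exprSr; apply: lin_span_scale.
have [jd|] := ltnP j.+1 d.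
  exists (fun k => (k == Ordinal jd)%:R).
  rewrite (bigD1 (Ordinal jd)) //= eqxx rmorph1 mul1r big1 ?addr0 // => k.
  by move=> /negPf->; rewrite rmorph0 mul0r.
move=> dj; have {dj} -> : j.+1 = d by apply/eqP; rewrite eqn_leq dj ltn_ord.
exists (fun k : 'I_d => - (p`_k / lead_coef p)).
have := pg; rewrite horner_coef size_map_poly szp big_ord_recr /= !coef_map /=.
have -> : p`_d = lead_coef p by rewrite lead_coefE szp.
have ln0 : phi (lead_coef p) != 0 by rewrite fmorph_eq0 lead_coef_eq0.
move=> /eqP; rewrite addrC addr_eq0 => /eqP e.
apply: (mulfI ln0); rewrite e mulr_sumr -sumrN; apply: eq_bigr => k _.
by rewrite coef_map rmorphN fmorph_div mulNr mulrN mulrA mulrCA mulfV // mulr1.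
Qed.

(** [M'] is M[g], spanned by the products of the [Y i] with finitely many powers of g. *)
Lemma adjoin_spanned (M : set F) (I : finType) (Y : I -> F) g :
  subring_closed [in M] -> M `<=` lin_span Y -> algebraicOver phi g ->
  exists M' : set F, [/\ subring_closed [in M'], M `<=` M', M' g &
    exists (J : finType) (Z : J -> F), M' `<=` lin_span Z].
Proof.
move=> closedM MY /lin_span_powers[d gd].
pose oM := GRing.isSubringClosed.Build F [in M] closedM.
pose M' : set F := [set z | exists2 h : {poly F}, h \is a polyOver [in M] & z = h.[g]].
pose Mc : subringClosed F := HB.pack [in M] oM.
have M'P h : h \is a polyOver Mc <-> h \is a polyOver [in M] by [].
exists M'; split.
- split.
  + by rewrite inE; exists 1; rewrite ?hornerC // -M'P rpred1.
  + move=> _ _ /set_mem[h hM ->] /set_mem[k kM ->]; rewrite inE.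
    by exists (h - k); rewrite ?hornerD ?hornerN // -M'P rpredB.
  + move=> _ _ /set_mem[h hM ->] /set_mem[k kM ->]; rewrite inE.
    by exists (h * k); rewrite ?hornerM // -M'P rpredM.
- move=> m Mm; exists m%:P; rewrite ?hornerC // -M'P polyOverC; exact/mem_set.
- by exists 'X; rewrite ?hornerX // -M'P polyOverX.
exists (I * 'I_d)%type, (fun ij : I * 'I_d => Y ij.1 * g ^+ ij.2) => _ [h hM ->].
have /polyOverP {}hM : h \is a polyOver Mc := hM.
rewrite horner_coef; apply: lin_span_sum => i.
by apply: (lin_span_mul (Z := fun j : 'I_d => g ^+ j)); [apply/MY/set_mem|].
Qed.

End Span.

(** Dividing an annihilating polynomial by a power of X leaves one with constant term c != 0, of the
    form h X + c; then h(u) u = - c. *)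
Lemma algebraic_inverse (E F : fieldType) (phi : {rmorphism E -> F}) u :
  algebraicOver phi u -> u != 0 -> exists h : {poly E}, u^-1 = (map_poly phi h).[u].
Proof.
case=> p pn0 pu un0; have [m [q + pE]] := multiplicity_XsubC p 0.
rewrite pn0 => /= q0; move: pu; rewrite pE rmorphM /= rootM => /orP[qu|]; last first.
  by rewrite subr0 rmorphXn /= map_polyX /root hornerXn expf_eq0 (negPf un0) andbF.
have : root (q - q.[0]%:P) 0 by rewrite /root hornerD hornerN hornerC subrr.
move: q0 qu; rewrite {1}/root; move: q.[0] => c c0 qu.
case/factor_theorem=> h; rewrite subr0 => /eqP; rewrite subr_eq => /eqP qE.
exists ((- c^-1)%:P * h); move: qu; rewrite qE rmorphD rmorphM /= map_polyX map_polyC.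
rewrite /root hornerD hornerM hornerX hornerC addr_eq0 => /eqP e.
rewrite rmorphM /= map_polyC hornerM hornerC /= rmorphN fmorphV.
by apply: (mulIf un0); rewrite mulVf // -mulrA e mulrNN mulVf // fmorph_eq0.
Qed.

(** Adjoining the generators one at a time as a ring keeps the span finite, and by
    [algebraic_inverse] the resulting ring is already closed under division. *)
Lemma finite_field_spanned (E F : fieldType) (phi : {rmorphism E -> F}) (s : seq F) :
  (forall x, algebraicOver phi x) -> field_gen (range phi `|` [set` s]) = setT ->
  exists (I : finType) (Y : I -> F), forall x, lin_span phi Y x.
Proof.
move=> alg gen.
suff [M [closedM phiM sM [I [Y MY]]]] : exists M : set F,
    [/\ subring_closed [in M], range phi `<=` M, [set` s] `<=` M &
     exists (I : finType) (Y : I -> F), M `<=` lin_span phi Y].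
  exists I, Y => x; apply: MY; have : [set: F] x by [].
  rewrite -gen; apply; split; last by rewrite subUset.
  pose oM := GRing.isSubringClosed.Build F [in M] closedM.
  pose Mc : subringClosed F := HB.pack [in M] oM.
  split=> [||a b aM bM]; [exact: (rpred1 Mc)|exact: (rpredB (S := Mc))|].
  have [->|bn0] := eqVneq b 0; first by rewrite invr0 mulr0 (rpred0 Mc).
  apply: (rpredM (s := Mc)) => //; have [h ->] := algebraic_inverse (alg b) bn0.
  apply: (rpred_horner (S := Mc)) => //.
  by apply/polyOverP => i; rewrite coef_map; apply/mem_set/phiM; exists h`_i.
elim: s {gen} => [|g s [M [closedM phiM sM [I [Y MY]]]]]; last first.
  have [M' [closedM' MM' M'g M'Z]] := adjoin_spanned closedM MY (alg g).
  exists M'; split=> // [x /phiM/MM'//|x /=].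
  by rewrite inE => /orP[/eqP->//|/sM/MM'].
exists (range phi); split => //.
  split; first by rewrite inE; exists 1; rewrite ?rmorph1.
    move=> _ _ /set_mem[a _ <-] /set_mem[b _ <-]; rewrite inE.
    by exists (a - b); rewrite ?rmorphB.
  move=> _ _ /set_mem[a _ <-] /set_mem[b _ <-]; rewrite inE.
  by exists (a * b); rewrite ?rmorphM.
exists unit, (fun=> 1) => _ [a _ <-]; exists (fun=> a).
by rewrite big_const card_unit /= addr0 mulr1.
Qed.

Lemma polyOver_set (F : fieldType) (A : set F) (p : {poly F}) :
  (forall i, A p`_i) -> p \is a polyOver [in A].
Proof. by move=> Ap; apply/(all_nthP 0) => i _; apply/mem_set. Qed.

Section Rank.
Context (K F : fieldType) (iota : {rmorphism K -> F}).

Lemma field_gen_closed (G : set F) : divring_closed [in field_gen G].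
Proof.
split=> [|x y xG yG|x y xG yG]; rewrite inE => A [A_closed GA];
  have [A1 AB AD] := A_closed; apply/set_mem => //.
  by apply: AB; apply/mem_set; [move/set_mem: xG|move/set_mem: yG]; apply.
by apply: AD; apply/mem_set; [move/set_mem: xG|move/set_mem: yG]; apply.
Qed.

Lemma adjoin_ev t p : adjoin iota [set t] (ev iota t p).
Proof.
move=> A [closedA]; rewrite subUset => -[KA tA].
pose oA := GRing.isDivringClosed.Build F [in A] closedA.
pose Ac : divringClosed F := HB.pack [in A] oA.
apply/set_mem; apply: (rpred_horner (S := Ac)); last by apply/mem_set/tA.
by apply/polyOverP => i; rewrite coef_map; apply/mem_set/KA; exists p`_i.
Qed.

Lemma adjoin1_frac t x : adjoin iota [set t] x ->
  exists p q, ev iota t q != 0 /\ x = ev iota t p / ev iota t q.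
Proof.
move=> /(_ [set y | exists p q, ev iota t q != 0 /\ y = ev iota t p / ev iota t q]).
apply; split; last first.
  rewrite subUset; split=> [_ [c _ <-]|_ ->].
    by exists c%:P, 1; rewrite rmorph1 oner_neq0 evC divr1.
  by exists 'X, 1; rewrite rmorph1 oner_neq0 evX divr1.
split.
- by rewrite inE; exists 1, 1; rewrite rmorph1 oner_neq0 divr1.
- move=> _ _ /set_mem[p [q [qn0 ->]]] /set_mem[p' [q' [qn0' ->]]]; rewrite inE.
  exists (p * q' - p' * q), (q * q'); split; first by rewrite rmorphM mulf_neq0.
  by rewrite -mulNr addf_div // rmorphB !rmorphM mulNr.
- move=> _ _ /set_mem[p [q [qn0 ->]]] /set_mem[p' [q' [qn0' ->]]]; rewrite inE.
  have [p0|pn0] := eqVneq (ev iota t p') 0.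
    by exists 0, 1; rewrite p0 mul0r invr0 mulr0 rmorph1 oner_neq0 rmorph0 mul0r.
  exists (p * q'), (q * p'); split; first by rewrite rmorphM mulf_neq0.
  by rewrite invf_div mulf_div !rmorphM.
Qed.

Lemma algebraic_over_subfieldP (A : set F) (closedA : divring_closed [in A]) x :
  algebraic_over_subfield A x ->
  algebraicOver (\val : subfield_of closedA -> F) x.
Proof.
case=> p pn0 [pA px].
pose oA := GRing.isDivringClosed.Build F [in A] closedA.
pose Ac : divringClosed F := HB.pack [in A] oA.
have /polyOverP {}pA : p \is a polyOver Ac := pA.
have qE : map_poly (\val : subfield_of closedA -> F)
    (\poly_(i < size p) insubd (0 : subfield_of closedA) p`_i) = p.
  apply/polyP => i; rewrite coef_map coef_poly; case: ltnP => ip.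
    by rewrite /= insubdK // pA.
  by rewrite raddf0 nth_default.
exists (\poly_(i < size p) insubd (0 : subfield_of closedA) p`_i).
  by apply: contra_neq pn0 => q0; rewrite -qE q0 rmorph0.
by rewrite qE.
Qed.

Lemma bivariate_annihilator t x : algebraic_over_subfield (adjoin iota [set t]) x ->
  exists P : {poly {poly K}},
    map_poly (ev iota t) P != 0 /\ root (map_poly (ev iota t) P) x.
Proof.
case=> p pn0 [pA px].
pose oA := GRing.isDivringClosed.Build F [in adjoin iota [set t]] (@field_gen_closed _).
pose Ac : divringClosed F := HB.pack [in adjoin iota [set t]] oA.
have /polyOverP {}pA : p \is a polyOver Ac := pA.
have /choice[a /choice[b ab]] := fun i => adjoin1_frac (set_mem (pA i)).
pose B := \prod_(i < size p) b i.
have Bn0 : ev iota t B != 0.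
  by rewrite rmorph_prod prodf_seq_neq0; apply/allP => i _; case: (ab i).
pose P := \poly_(i < size p) (a i * \prod_(k < size p | k != i :> nat) b k).
have PE : map_poly (ev iota t) P = ev iota t B *: p.
  apply/polyP => i; rewrite coef_map coefZ coef_poly /=; case: ltnP => ip; last first.
    by rewrite rmorph0 nth_default ?mulr0.
  rewrite (ab i).2 rmorphM [B](bigD1 (Ordinal ip)) //= [in RHS]rmorphM.
  by rewrite [RHS]mulrC !mulrA divfK // (ab i).1.
exists P; rewrite PE; split; first by rewrite scaler_eq0 negb_or Bn0.
by rewrite /root hornerZ (eqP px) mulr0.
Qed.

Lemma map_ev_swapXY t P :
  map_poly (ev iota t) P = (swapXY (map_poly (map_poly iota) P)).[t%:P].
Proof. by rewrite horner_swapXY -map_poly_comp. Qed.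

Lemma map_ev_eq0 t (P : {poly {poly K}}) : transcendental iota t ->
  (map_poly (ev iota t) P == 0) = (P == 0).
Proof.
move=> t_tr; apply/eqP/eqP => [/polyP P0|->]; last by rewrite rmorph0.
by apply/polyP => i; have /eqP := P0 i; rewrite coef_map !coef0 ev_eq0 // => /eqP.
Qed.

(** Exchange: t is algebraic over K(t0). As t is transcendental, the bivariate relation between them
    stays nonzero when read with the variables swapped, and makes t0 algebraic over K(t).
    Transitivity gives the rest. *)
Lemma algebraic_over_adjoin t : transcendence_degree_one iota ->
  transcendental iota t ->
  forall x, algebraicOver
    (\val : subfield_of (@field_gen_closed (range iota `|` [set t])) -> F) x.
Proof.
case=> t0 t0_tr alg0 t_tr x.
pose E := subfield_of (@field_gen_closed (range iota `|` [set t])).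
have K_sub c : iota c \in subfield_pred (@field_gen_closed (range iota `|` [set t])).
  by rewrite inE -(evC iota t); apply: adjoin_ev.
pose j c : E := Subfield (K_sub c).
have j_add : zmod_morphism j by move=> a b; apply: val_inj; rewrite /= !rmorphB.
have j_mul : monoid_morphism j.
  by split=> [|a b]; apply: val_inj; rewrite /= ?rmorph1 ?rmorphM.
pose jm : {rmorphism K -> E} := HB.pack j
  (GRing.isZmodMorphism.Build _ _ j j_add) (GRing.isMonoidMorphism.Build _ _ j j_mul).
have t0_alg : algebraicOver (\val : E -> F) t0.
  apply: algebraic_over_subfieldP.
  have [P [Pn0 Pt]] := bivariate_annihilator (alg0 t).
  exists (map_poly (ev iota t) (swapXY P)).
    by rewrite map_ev_eq0 // swapXY_eq0; apply: contra_neq Pn0 => ->; rewrite rmorph0.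
  split.
    by apply: polyOver_set => i; rewrite coef_map; apply: adjoin_ev.
  move: Pt; rewrite /root !map_ev_swapXY -swapXY_map swapXYK.
  by rewrite horner2_swapXY.
have [P [Pn0 Px]] := bivariate_annihilator (alg0 x).
have pE : (map_poly (map_poly (\val : E -> F))
    (swapXY (map_poly (map_poly jm) P))).[t0%:P] = map_poly (ev iota t0) P.
  rewrite map_ev_swapXY -swapXY_map -map_poly_comp.
  congr (swapXY _).[_]; apply: eq_map_poly => p /=.
  have j0 : j 0 = 0 by apply: val_inj; rewrite /= rmorph0.
  by apply/polyP => i; rewrite coef_map_id0 // coef_map_id0 // coef_map_id0 // rmorph0.
apply: algebraic_root_polyXY t0_alg.
by exists (swapXY (map_poly (map_poly jm) P)); rewrite pE.
Qed.

(** F is generated over K(t) by finitely many algebraic elements, hence spanned by finitely many;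
    their number is the bound. *)
Lemma rank_finite t : function_field iota -> transcendental iota t ->
  exists n, rank_le iota t n.
Proof.
case=> -[G /finite_seqP[s ->] genF] trd t_tr.
pose E := subfield_of (@field_gen_closed (range iota `|` [set t])).
pose phi : {rmorphism E -> F} := (\val : E -> F).
have alg : forall x, algebraicOver phi x := algebraic_over_adjoin trd t_tr.
have gen : field_gen (range phi `|` [set` s]) = setT.
  apply/seteqP; split=> // z _; have : [set: F] z by [].
  rewrite -genF; apply: sub_smallest2r; first exact: field_gen_closed.
  apply: setSU => _ [c _ <-]; rewrite -(evC iota t).
  by exists (Subfield (mem_set (@adjoin_ev t c%:P))).
have [I [Y spanY]] := finite_field_spanned alg gen.
exists #|I| => f; have /choice[c fE] := fun k => spanY (f k).
have [|r [k0 rk0] rE] := @lin_dep _ _ _ c; first by rewrite card_ord.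
have /choice[a /choice[b ab]] := fun k => adjoin1_frac (set_mem (valP (r k))).
have bn0 k : ev iota t (b k) != 0 := (ab k).1.
(* The relation with coefficients a_k / b_k, multiplied by the product of all denominators. *)
exists (fun k => a k * \prod_(l | l != k) b l).
  exists k0; rewrite mulf_neq0 //.
    apply: contraNneq rk0 => a0; rewrite -(inj_eq val_inj) (ab k0).2 a0.
    by rewrite rmorph0 mul0r.
  by apply/prodf_neq0 => l _; apply: contraNneq (bn0 l) => ->; rewrite rmorph0.
transitivity (ev iota t (\prod_l b l) * \sum_k phi (r k) * f k).
  rewrite mulr_sumr; apply: eq_bigr => k _; rewrite mulrA; congr (_ * _).
  rewrite /= (ab k).2 rmorphM [in RHS](bigD1 k) //= [in RHS]rmorphM.
  by rewrite mulrC [RHS]mulrC !mulrA divfK // mulrC.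
under [X in _ * X]eq_bigr => k _ do rewrite fE mulr_sumr.
rewrite [X in _ * X]exchange_big /= [X in _ * X]big1 ?mulr0 // => i _.
transitivity (phi (\sum_k r k * c k i) * Y i); last by rewrite rE rmorph0 mul0r.
rewrite rmorph_sum mulr_suml; apply: eq_bigr => k _.
by rewrite [phi _]rmorphM -mulrA.
Qed.

End Rank.

(** * Places and discrete valuations *)

Section Valuation.
Context (F : fieldType) (v : F -> \bar int) (dv : discrete_valuation v).

(** Such a bound includes x = 0 and keeps most of the arithmetic out of [\bar int]; its negation is
    the strict inequality w x < k. *)
Definition vge (w : F -> \bar int) (k : int) (x : F) : Prop := (k%:E <= w x)%E.

Lemma dval_ninfty x : v x != -oo%E.
Proof.
have : range v (v x) by exists x.
by rewrite (dval_range dv) => /=.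
Qed.

Lemma dval0 : v 0 = +oo%E. Proof. exact/(dval_infty dv). Qed.

Lemma dval_fin x : x != 0 -> exists k : int, v x = k%:E.
Proof.
move=> xn0; case vx: (v x) => [k| |]; first by exists k.
  by move/(dval_infty dv): vx xn0 => ->; rewrite eqxx.
by have := dval_ninfty x; rewrite vx.
Qed.

Lemma dval_one : v 1 = 0%E.
Proof.
have [k vk] := dval_fin (oner_neq0 F); have := dvalM dv 1 1.
rewrite mulr1 vk => -[] /eqP; rewrite -subr_eq0 opprD addNKr oppr_eq0.
by move=> /eqP ->.
Qed.

Lemma dvalV x (k : int) : v x = k%:E -> v x^-1 = (- k)%:E.
Proof.
move=> vx; have xn0 : x != 0.
  by apply/eqP => x0; move: vx; rewrite x0 dval0.
have [l vl] : exists l : int, v x^-1 = l%:E by apply: dval_fin; rewrite invr_eq0.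
have := dvalM dv x x^-1; rewrite mulfV // dval_one vx vl => -[] /eqP.
by rewrite eq_sym addrC addr_eq0 => /eqP ->.
Qed.

Lemma vge0 k : vge v k 0. Proof. by rewrite /vge dval0 leey. Qed.

Lemma vge_le j k x : (j <= k)%R -> vge v k x -> vge v j x.
Proof. by move=> jk; apply: le_trans; rewrite lee_fin. Qed.

Lemma vgeM j k x y : vge v j x -> vge v k y -> vge v (j + k) (x * y).
Proof. by move=> xj yk; rewrite /vge (dvalM dv) EFinD leeD. Qed.

Lemma vgeD k x y : vge v k x -> vge v k y -> vge v k (x + y).
Proof. by move=> xk yk; apply: le_trans (dvalD dv x y); rewrite le_min xk. Qed.

Lemma vge1 : vge v 0 1. Proof. by rewrite /vge dval_one. Qed.

Lemma not_vge1 : ~ vge v 1 1. Proof. by rewrite /vge dval_one lee_fin. Qed.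

Lemma vgeV k x : ~ vge v k x -> vge v (1 - k) x^-1.
Proof.
have [->|xn0] := eqVneq x 0; first by case; apply: vge0.
have [l vl] := dval_fin xn0; rewrite /vge (dvalV vl) vl !lee_fin => /negP.
by lia.
Qed.

(** It suffices that v(-1) >= 0. Otherwise, -1 being its own inverse, v(-1) >= 1, which contradicts
    (-1)^2 = 1. *)
Lemma vgeN k x : vge v k x -> vge v k (- x).
Proof.
move=> xk; rewrite -mulN1r -[k]add0r; apply: vgeM => //; apply: contrapT => n1.
have n2 := vgeV n1; rewrite invrN invr1 subr0 in n2.
by have := vgeM n2 n2; rewrite mulrNN mulr1; move/(vge_le (_ : 1 <= 1 + 1)%R)/not_vge1; apply.
Qed.

Lemma vgeB k x y : vge v k x -> vge v k y -> vge v k (x - y).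
Proof. by move=> xk /vgeN; apply: vgeD. Qed.

Lemma vge_sum (I : finType) (P : pred I) (f : I -> F) k :
  (forall i, P i -> vge v k (f i)) -> vge v k (\sum_(i | P i) f i).
Proof.
move=> fk; elim/big_ind: _ => //; [exact: vge0|exact: vgeD].
Qed.

Lemma vgeX k x n : vge v k x -> vge v (k *+ n) (x ^+ n).
Proof.
by move=> xk; elim: n => [|n IH]; rewrite ?mulrSr ?exprSr; [apply: vge1|apply: vgeM].
Qed.

Lemma vge0X x n : vge v 0 x -> vge v 0 (x ^+ n).
Proof. by move/(@vgeX _ _ n); rewrite mul0rn. Qed.

Lemma vge_exact x : x != 0 -> exists k, vge v k x /\ ~ vge v (k + 1) x.
Proof.
move=> xn0; have [k vk] := dval_fin xn0; exists k.
by rewrite /vge vk !lee_fin lexx gerDl.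
Qed.

Lemma vgeDN k x y : ~ vge v k x -> vge v k y -> ~ vge v k (x + y).
Proof. by move=> xk yk xyk; apply: xk; rewrite -[x](addrK y); apply: vgeB. Qed.

Lemma vgt0E x : (0 < v x)%E <-> vge v 1 x.
Proof.
have [->|xn0] := eqVneq x 0; first by rewrite /vge dval0 leey; split=> // _; rewrite ltey.
by have [k vk] := dval_fin xn0; rewrite /vge vk lte_fin lee_fin -gtz0_ge1.
Qed.

Lemma vlt0E x : (v x < 0)%E <-> ~ vge v 0 x.
Proof. by rewrite /vge ltNge; split=> /negP. Qed.

Lemma dval_uniformizer : exists t, vge v 1 t /\ ~ vge v 2 t.
Proof.
have : range v 1%:E by rewrite (dval_range dv).
case=> t _ vt.
by exists t; rewrite /vge vt !lee_fin lexx.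
Qed.

End Valuation.

Section Places.
Context (K F : fieldType) (iota : {rmorphism K -> F}).

Definition place_valuation (v : F -> \bar int) :=
  discrete_valuation v /\ forall c, vge v 0 (iota c).

Definition center (v : F -> \bar int) : set F := [set x | vge v 1 x].

Lemma valuation_ofE P v : valuation_of P v <-> discrete_valuation v /\ P = center v.
Proof.
suff E : discrete_valuation v -> center v = [set x | (0 < v x)%E].
  by split=> -[dv ->]; split; rewrite ?E.
by move=> dv; apply/seteqP; split=> x /= /(vgt0E dv).
Qed.

Lemma maximal_center v : discrete_valuation v ->
  is_maximal_ideal [set x | vge v 0 x] (center v).
Proof.
move=> dv; split.
- split=> [x||x y|a x]; [exact: vge_le|exact: vge0|exact: vgeD|].
  by move=> av xv; have := vgeM dv av xv; rewrite add0r.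
- by move/seteqP => -[_ /(_ 1)] /(_ (vge1 dv))/(not_vge1 dv).
move=> J [JO J0 JD JM] PJ JnO; apply/seteqP; split=> // x Jx; apply: contrapT => xv.
apply: JnO; apply/seteqP; split=> // y yv; have xn0 : x != 0.
  by apply/eqP => x0; apply: xv; rewrite x0; apply: vge0.
rewrite -[y](mulfVK xn0); apply: JM => //.
by have := vgeM dv yv (vgeV dv xv); rewrite add0r subrr.
Qed.

Lemma place_center P : is_place iota P ->
  exists v, place_valuation v /\ P = center v.
Proof.
case=> O [[v dv OE] KO [[PO P0 PD PM] PnO Pmax]]; rewrite {}OE in KO PO PD PM PnO Pmax.
exists v; split; first by split=> // c; apply: KO; exists c.
have [iP cnO _] := maximal_center dv.
apply/esym/Pmax => // x Px; apply: contrapT => xv.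
apply: PnO; apply/seteqP; split=> // y yv; have xn0 : x != 0.
  by apply/eqP => x0; apply: xv; rewrite x0; apply: vge0.
rewrite -[y](mulfVK xn0); apply: PM => //.
by have := vgeM dv yv (vgeV dv xv); rewrite add0r subrr.
Qed.

Lemma center_place v : place_valuation v -> is_place iota (center v).
Proof.
case=> dv Kv; exists [set x | vge v 0 x]; split; last exact: maximal_center.
  by exists v.
by move=> _ [c _ <-]; apply: Kv.
Qed.

(** A constant of negative value at w would have its inverse in the center of w, which is that of v,
    where constants have no poles. *)
Lemma center_unique_trivial v w : place_valuation v -> discrete_valuation w ->
  center v = center w -> place_valuation w.
Proof.
case=> dv Kv dw vw; split=> // c; apply: contrapT => wc.
have := vgeV dw wc; rewrite subr0 => wc'.
have : center v (iota c)^-1 by rewrite vw.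
move=> /(vgeM dv (Kv c)); rewrite add0r mulfV => [/(not_vge1 dv)//|].
by apply/eqP => c0; apply: wc; rewrite c0; apply: vge0.
Qed.

Lemma S_integralP S f : S_integral iota S f <->
  forall v, place_valuation v -> ~ S (center v) -> vge v 0 f.
Proof.
split=> [Sf v Kv nS|Sf P pP nSP [v /valuation_ofE[dv PE] /vlt0E]].
  have [dv _] := Kv; apply: contrapT => /vlt0E vf.
  apply: (Sf _ (center_place Kv) nS); exists v; last exact: vf.
  by apply/valuation_ofE.
apply; apply: Sf; last by rewrite -PE.
have [w [Kw wE]] := place_center pP.
by apply: center_unique_trivial Kw dv _; rewrite -wE.
Qed.

End Places.

(** * Existence of poles *)

Section PolynomialDependence.
Context (K F : fieldType) (iota : {rmorphism K -> F}).

Lemma ev_split t p : exists q, ev iota t p = iota p`_0 + t * ev iota t q.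
Proof.
have : root (p - (p`_0)%:P) 0 by rewrite /root hornerD hornerN hornerC horner_coef0 subrr.
case/factor_theorem=> q; rewrite subr0 => /eqP; rewrite subr_eq => /eqP pE.
by exists q; rewrite {1}pE rmorphD rmorphM /= evX evC addrC mulrC.
Qed.

(** Powers of t are cancelled until some constant term is nonzero. Reducing such a relation modulo t
    leaves nontrivial coefficients in K. *)
Lemma dependent_primitive t (I : finType) (f : I -> F) :
  t != 0 -> poly_dependent iota t f ->
  exists2 p : I -> {poly K}, (exists i, (p i)`_0 != 0) & \sum_i ev iota t (p i) * f i = 0.
Proof.
move=> tn0 [p]; move: {2}(\sum_i size (p i))%N (leqnn (\sum_i size (p i))) => n.
elim: n p => [|n IH] p szp [i0 pi0] pf.
  by move: szp pi0; rewrite leqn0 sum_nat_eq0 => /forallP/(_ i0)/=; rewrite size_poly_eq0 => ->.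
have [[i pi]|nex] := pselect (exists i, (p i)`_0 != 0); first by exists p => //; exists i.
have p0 i : (p i)`_0 = 0 by apply/eqP/negPn/negP => pi; apply: nex; exists i.
have /choice[q qE] : forall i, exists q, p i = q * 'X.
  move=> i; have /factor_theorem[q qE] : root (p i) 0 by rewrite /root horner_coef0 p0.
  by exists q; rewrite qE subr0.
apply: (IH q).
- rewrite -ltnS (leq_trans _ szp) // (bigD1 i0) // [X in (_ < X)%N](bigD1 i0) //= -addSn.
  apply: leq_add.
    rewrite qE size_mulX //.
    by apply: contraNneq pi0 => q0; rewrite qE q0 mul0r.
  apply: leq_sum => i _; rewrite qE.
  by have [->|qi0] := eqVneq (q i) 0; rewrite ?mul0r // size_mulX // leqnSn.
- by exists i0; apply: contraNneq pi0 => q0; rewrite qE q0 mul0r.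
apply: (mulfI tn0); rewrite mulr0 -[RHS]pf mulr_sumr; apply: eq_bigr => i _.
by rewrite qE rmorphM /= evX mulrA [t * _]mulrC.
Qed.

End PolynomialDependence.

Definition is_subring (F : fieldType) (A : set F) : Prop :=
  [/\ A 1, forall x y, A x -> A y -> A (x - y) & forall x y, A x -> A y -> A (x * y)].

Section Subring.
Context (F : fieldType) (A : set F) (ringA : is_subring A).

Lemma subring0 : A 0.
Proof. by have [A1 AB _] := ringA; rewrite -(subrr 1); apply: (AB). Qed.

Lemma subringN x : A x -> A (- x).
Proof. by have [_ AB _] := ringA; rewrite -sub0r; apply: (AB); apply: subring0. Qed.

Lemma subringD x y : A x -> A y -> A (x + y).
Proof. by have [_ AB _] := ringA; move=> Ax /subringN; rewrite -{2}[y]opprK; apply: (AB). Qed.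

Lemma subring_sum (I : finType) (P : pred I) (f : I -> F) :
  (forall i, P i -> A (f i)) -> A (\sum_(i | P i) f i).
Proof. by move=> fA; elim/big_ind: _ => //; [exact: subring0|exact: subringD]. Qed.

Lemma subringX x n : A x -> A (x ^+ n).
Proof.
by have [A1 _ AM] := ringA; move=> Ax; elim: n => [|n]; rewrite ?exprS //; apply: (AM).
Qed.

Lemma subring_horner (h : {poly F}) x : (forall i, A h`_i) -> A x -> A h.[x].
Proof.
have [_ _ AM] := ringA.
move=> hA Ax; rewrite horner_coef; apply: subring_sum => i _.
by apply: (AM) => //; apply: subringX.
Qed.

Lemma is_subring_adjoin u :
  is_subring [set z | exists2 h : {poly F}, (forall i, A h`_i) & z = h.[u]].
Proof.
have [A1 AB AM] := ringA; split.
- by exists 1; rewrite ?hornerC // => i; rewrite coef1; case: eqP => // _; apply: subring0.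
- move=> _ _ [h hA ->] [k kA ->]; exists (h - k); rewrite ?hornerD ?hornerN // => i.
  by rewrite coefB; apply: (AB).
move=> _ _ [h hA ->] [k kA ->]; exists (h * k); rewrite ?hornerM // => i.
by rewrite coefM; apply: subring_sum => j _; apply: (AM).
Qed.

End Subring.

Section ExistsValuationRing.
Context (K F : fieldType) (iota : {rmorphism K -> F}).

(* t^-1 is a polynomial expression of degree at most k in z over A. *)
Let E (A : set F) t k z :=
  exists h : {poly F}, [/\ forall i, A h`_i, (size h <= k.+1)%N & t^-1 = h.[z]].

(** Write t^-1 = g_0 + (1 - t g_0) h(z). The relation for z^-1 gives 1 - t g_0 = sum_j t g_(j+1)
    z^-(j+1), so the top term of h drops to the degrees k - j. *)
Let lower_degree (A : set F) t k l z : is_subring A -> A t -> t != 0 -> z != 0 ->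
  (l <= k.+1)%N -> E A t k.+1 z -> E A t l z^-1 -> E A t k z.
Proof.
move=> ringA At tn0 zn0 lk [h [hA szh hE]] [g [gA szg gE]].
have [A1 AB AM] := ringA.
exists ((g`_0)%:P + (1 - t * g`_0) *: \poly_(i < k.+1) h`_i
  + \sum_(j < l) (t * h`_k.+1 * g`_j.+1) *: 'X^(k - j)).
have AX n i : A ('X^n : {poly F})`_i.
  by rewrite coefXn; case: eqP => // _; apply: subring0.
split.
- move=> i; rewrite !coefD coefC coefZ coef_poly coef_sum; apply: subringD => //.
    apply: subringD => //; first by case: eqP => // _; apply: subring0.
    by apply: (AM); [apply: (AB) => //; apply: (AM)|case: ifP => // _; apply: subring0].
  apply: subring_sum => // j _; rewrite coefZ; apply: (AM) => //.
  by apply: (AM) => //; apply: (AM).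
- rewrite (leq_trans (size_polyD _ _)) // geq_max (leq_trans (size_polyD _ _)) /=.
    rewrite (leq_trans (size_sum _ _ _)) //; apply/bigmax_leqP => j _.
    by rewrite (leq_trans (size_scale_leq _ _)) // size_polyXn ltnS leq_subr.
  rewrite geq_max (leq_trans (size_polyC_leq1 _)) //.
  by rewrite (leq_trans (size_scale_leq _ _)) // size_poly.
have hz : t^-1 = (\poly_(i < k.+1) h`_i).[z] + h`_k.+1 * z ^+ k.+1.
  by rewrite hE (horner_coef_wide _ szh) big_ord_recr /= horner_poly.
have gz : 1 - t * g`_0 = \sum_(j < l) t * g`_j.+1 * z^-1 ^+ j.+1.
  apply/eqP; rewrite subr_eq -(mulfV tn0) gE (horner_coef_wide _ szg) big_ord_recl expr0 mulr1.
  by rewrite mulrDr addrC mulr_sumr; apply/eqP; congr (_ + _); apply: eq_bigr => j _; rewrite mulrA.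
rewrite !hornerD hornerC hornerZ horner_sum.
have -> : \sum_(j < l) ((t * h`_k.+1 * g`_j.+1) *: 'X^(k - j)).[z]
    = (1 - t * g`_0) * (h`_k.+1 * z ^+ k.+1).
  rewrite gz mulr_suml; apply: eq_bigr => j _; rewrite hornerZ hornerXn.
  have jk : (j <= k)%N by rewrite -ltnS (leq_trans (ltn_ord j)).
  have -> : z ^+ k.+1 = z ^+ (k - j) * z ^+ j.+1 by rewrite -exprD addnS subnK.
  have := expf_neq0 j.+1 zn0; rewrite exprVn.
  by move: (z ^+ j.+1) (z ^+ (k - j)) => zj zkj zjn0; field.
rewrite -addrA -mulrDr -hz mulrBl mul1r mulrAC mulfV // mul1r addrC subrK //.
Qed.

(** Descent on k + l: the larger of the two degrees can always be lowered, and degree 0 would put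
    t^-1 in A. *)
Let not_both (A : set F) t : is_subring A -> A t -> t != 0 -> ~ A t^-1 ->
  forall n k l z, (k + l <= n)%N -> z != 0 -> E A t k z -> E A t l z^-1 -> False.
Proof.
move=> ringA At tn0 At'; have E0 z : ~ E A t 0 z.
  case=> h [hA szh hE]; apply: At'; rewrite hE (size1_polyC szh) hornerC //.
elim=> [|n IH] k l z kln zn0 Ek El.
  by move: kln Ek; rewrite leqn0 addn_eq0 => /andP[/eqP-> _] /E0.
have [lk|kl] := leqP l k.
  case: k lk kln Ek => [|k] lk kln Ek; first exact: E0 Ek.
  by apply: (IH k l z) => //; apply: lower_degree Ek El.
case: l kl kln El => [//|l] kl kln El.
apply: (IH k l z) => //; first by rewrite addnS in kln.
by apply: (@lower_degree A t l k) => //; rewrite ?invr_eq0 ?invrK // ltnW.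
Qed.

(* A subring that is maximal among those containing K[t] but not t^-1 is a
   valuation ring. *)
Lemma exists_valuation_ring t : transcendental iota t ->
  exists A : set F, [/\ is_subring A, range iota `<=` A, forall z, A z \/ A z^-1,
    A t & ~ A t^-1].
Proof.
move=> t_tr; have tn0 : t != 0.
  by apply/eqP => t0; apply: t_tr; rewrite t0; apply: algebraic0.
pose Q (A : set F) := [/\ is_subring A, range iota `<=` A, A t & ~ A t^-1].
pose P (A : set F) := A = set0 \/ Q A.
have [G GP Gtot|A [PA maxA]] := @Zorn_bigcup F P.
  have [[X0 [GX0 [x0 X0x0]]]|none] := pselect (exists X, G X /\ X !=set0); last first.
    left; apply/seteqP; split=> // x [X GX Xx]; apply: none.
    by exists X; split => //; exists x.
  right; have Gne X x : G X -> X x -> Q X.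
    by move=> /GP[->|].
  have [ring0 K0 t0 t0'] := Gne _ _ GX0 X0x0.
  have pair x y : (\bigcup_(X in G) X) x -> (\bigcup_(X in G) X) y ->
      exists X, [/\ G X, is_subring X, X x & X y].
    move=> [X GX Xx] [Y GY Yy].
    have [XY|YX] := Gtot X Y GX GY.
      by have [rY _ _ _] := Gne _ _ GY Yy; exists Y; split => //; apply: XY.
    by have [rX _ _ _] := Gne _ _ GX Xx; exists X; split => //; apply: YX.
  split.
  - split; first by exists X0 => //; case: ring0.
      by move=> x y /pair h/h[X [GX [_ XB _] Xx Xy]]; exists X => //; apply: XB.
    by move=> x y /pair h/h[X [GX [_ _ XM] Xx Xy]]; exists X => //; apply: XM.
  - by move=> x /K0; exists X0.
  - by exists X0.
  by case=> X GX Xt; have [_ _ _] := Gne _ _ GX Xt; apply.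
have QA : Q A.
  case: PA => [A0|//]; case: (maxA (range (ev iota t))).
    rewrite A0; split=> // /(_ 1) h; apply: h; exists 1 => //; exact: rmorph1.
  right; split.
  - split; first by exists 1; rewrite ?rmorph1.
      by move=> _ _ [p _ <-] [q _ <-]; exists (p - q); rewrite ?rmorphB.
    by move=> _ _ [p _ <-] [q _ <-]; exists (p * q); rewrite ?rmorphM.
  - by move=> _ [c _ <-]; exists c%:P; rewrite ?evC.
  - by exists 'X; rewrite ?evX.
  case=> p _ pE; apply: t_tr; exists (p * 'X - 1).
    apply/eqP => /polyP/(_ 0%N)/eqP; rewrite coefB coefMX coef1 coef0 /= sub0r.
    by rewrite oppr_eq0 oner_eq0.
  by apply/eqP; rewrite -evE rmorphB rmorphM rmorph1 /= evX pE mulVf // subrr.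
have [ringA KA At At'] := QA; exists A; split => // z.
apply: contrapT => /not_orP[Az Az']; have [A1 AB AM] := ringA.
have zn0 : z != 0 by apply/eqP => z0; apply: Az; rewrite z0; apply: subring0.
(* A[u] is strictly larger than A, so by maximality it contains t^-1. *)
have ext u : ~ A u -> exists k, E A t k u.
  move=> Au; apply: contrapT => nE.
  pose A' : set F := [set w | exists2 h : {poly F}, (forall i, A h`_i) & w = h.[u]].
  have AA' : A `<=` A'.
    move=> a Aa; exists a%:P; rewrite ?hornerC // => i; rewrite coefC.
    by case: eqP => // _; apply: subring0.
  apply: (maxA A').
    split=> // A'A; apply: Au; apply: A'A; exists 'X; rewrite ?hornerX // => i.
    by rewrite coefX; case: eqP => // _; apply: subring0.
  right; split; [exact: is_subring_adjoin|by move=> x /KA/AA'|exact: AA'|].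
  by case=> h hA hE; apply: nE; exists (size h), h.
have [k Ek] := ext _ Az; have [l El] := ext _ Az'.
exact: (not_both ringA At tn0 At' (leqnn (k + l)) zn0 Ek El).
Qed.

End ExistsValuationRing.

(** * Discreteness of the valuation rings of a function field *)

Section DiscreteValuationRing.
Context (K F : fieldType) (iota : {rmorphism K -> F}).
Context (FK : function_field iota).
Context (A : set F) (ringA : is_subring A) (KA : range iota `<=` A).
Context (valA : forall z, A z \/ A z^-1).

(* The nonunits of A; since 0^-1 = 0 the element 0 needs a separate clause. *)
Let M : set F := [set x | x = 0 \/ ~ A x^-1].

Let AM x y : A x -> A y -> A (x * y). Proof. by have [_ _] := ringA; apply. Qed.

Let A1 : A 1. Proof. by case: ringA. Qed.

Let MA x : M x -> A x.
Proof. by case=> [->|]; [exact: subring0|case: (valA x)]. Qed.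

Let NM x : ~ M x -> x != 0 /\ A x^-1.
Proof. by move=> /not_orP[/eqP ? /contrapT]. Qed.

Let MM x y : M x -> A y -> M (y * x).
Proof.
move=> Mx Ay; apply: contrapT => /NM[]; rewrite mulf_eq0 negb_or => /andP[yn0 xn0] A'.
case: Mx => [x0|]; first by rewrite x0 eqxx in xn0.
by apply; have -> : x^-1 = y * (y * x)^-1 by [rewrite invfM mulVKf]; apply: AM.
Qed.

Let M0 : M 0. Proof. by left. Qed.

Let M1 : ~ M 1. Proof. by case=> [/eqP|]; rewrite ?oner_eq0 ?invr1. Qed.

Let MD x y : M x -> M y -> M (x + y).
Proof.
have [->|yn0] := eqVneq y 0; first by rewrite addr0.
have [->|xn0] := eqVneq x 0; first by rewrite add0r.
move=> Mx My; case: (valA (x / y)) => [Axy|].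
  have -> : x + y = (x / y + 1) * y by rewrite mulrDl divfK // mul1r.
  by apply: MM => //; apply: subringD.
rewrite invf_div => Ayx; have -> : x + y = (1 + y / x) * x by rewrite mulrDl divfK // mul1r.
by apply: MM => //; apply: subringD.
Qed.

Let ev_A t p : A t -> A (ev iota t p).
Proof.
by move=> At; apply: subring_horner => // i; rewrite coef_map; apply: KA; exists p`_i.
Qed.

Let M_transcendental t : M t -> t != 0 -> transcendental iota t.
Proof.
move=> Mt tn0 t_alg; have [h hE] := algebraic_inverse t_alg tn0.
have At := MA Mt; case: Mt => [t0|]; first by rewrite t0 eqxx in tn0.
by apply; rewrite hE; apply: ev_A.
Qed.

Let M_const c : M (iota c) -> c = 0.
Proof.
case=> [/eqP|]; first by rewrite fmorph_eq0 => /eqP.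
by rewrite -fmorphV => h; exfalso; apply: h; apply: KA; exists c^-1.
Qed.

(* A chain t = x_0, x_1, ... of nonunits in which each term is strictly divisible
   by the next is linearly independent over K(t). *)
Let no_chain n t (x : nat -> F) : rank_le iota t n -> x 0%N = t ->
  (forall i, (i <= n)%N -> M (x i) /\ x i != 0) ->
  (forall i, (i < n)%N -> M (x i / x i.+1)) -> False.
Proof.
move=> rk x0 xM xS; have [Mt tn0] := xM 0%N isT; rewrite x0 in Mt tn0.
have xlt i j : (i < j)%N -> (j <= n)%N -> M (x i / x j).
  elim: j => // j IH; rewrite ltnS leq_eqVlt => /orP[/eqP<-|ij] jn; first exact: xS.
  have [_ xj0] := xM j (ltnW jn).
  have -> : x i / x j.+1 = (x i / x j) * (x j / x j.+1) by rewrite mulrA divfK.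
  by apply: MM; [apply: xS|apply/MA/IH => //; apply: ltnW].
have [p [i0 pi0] px] := dependent_primitive tn0 (rk (fun i => x i)).
(* After division by x_j all other terms are nonunits: for i < j by divisibility along the chain,
   for i > j because p_i(0) = 0 supplies a factor t, which x_j divides. Then p_j(0) would be a
   nonunit too. *)
pose j := [arg max_(i > i0 | (p i)`_0 != 0) (i : nat)].
have [pj0 jmax] : (p j)`_0 != 0 /\ forall i, (p i)`_0 != 0 -> (i <= j)%N.
  by rewrite /j; case: arg_maxnP => // k pk kmax.
have [_ xj0] : M (x j) /\ x j != 0 by apply: xM; rewrite -ltnS.
have Mj : M (ev iota t (p j)).
  have : ev iota t (p j) * x j = \sum_(i | i != j) - (ev iota t (p i) * x i).
    by apply/eqP; rewrite sumrN -addr_eq0; apply/eqP; rewrite -[RHS]px [RHS](bigD1 j).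
  move=> pjE; rewrite -[ev iota t (p j)](mulfK xj0) pjE mulr_suml.
  elim/big_ind: _ => // i ij; rewrite mulNr -mulN1r; apply: (MM); last exact: subringN.
  have ile : (i <= n)%N by rewrite -ltnS.
  have [lij|lji|/val_inj e] := ltngtP i j; last by rewrite e eqxx in ij.
    by rewrite -mulrA; apply: MM; [apply: xlt; rewrite // -ltnS|apply/ev_A/MA].
  have [q ->] := ev_split iota t (p i); have -> : (p i)`_0 = 0.
    by apply/eqP/negPn/negP => /jmax; rewrite leqNgt lji.
  rewrite rmorph0 add0r.
  have -> : t * ev iota t q * x i / x j = ev iota t q * (t / x j) * x i by field.
  have [Mi _] := xM i ile; apply: MM => //; apply: AM; first exact/ev_A/MA.
  rewrite -x0; have [->|j0] := posnP j; first by rewrite divff ?x0.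
  by apply/MA/xlt; rewrite // -ltnS.
have [q qE] := ev_split iota t (p j).
have /M_const/eqP : M (iota (p j)`_0); last by rewrite (negPf pj0).
have -> : iota (p j)`_0 = ev iota t (p j) + (- ev iota t q) * t by rewrite qE; ring.
by apply: MD => //; apply: MM => //; apply: subringN => //; apply/ev_A/MA.
Qed.

(** [pi] is the last term of a longest chain starting at t: a nonunit y not divisible by it would
    divide it strictly and prolong the chain. *)
Let uniformizer t : M t -> t != 0 ->
  exists2 pi, M pi /\ pi != 0 & forall y, M y -> A (y / pi).
Proof.
move=> Mt tn0; have t_tr := M_transcendental Mt tn0.
have [n rk] := rank_finite FK t_tr.
pose chain k := exists x : nat -> F, [/\ x 0%N = t,
  forall i, (i <= k)%N -> M (x i) /\ x i != 0 &
  forall i, (i < k)%N -> M (x i / x i.+1)].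
have chain0 : exists k, `[< chain k >] by exists 0%N; apply/asboolP; exists (fun=> t).
have chain_bound k : `[< chain k >] -> (k <= n)%N.
  move=> /asboolP[x [x0 xM xS]]; rewrite leqNgt; apply/negP => nk.
  apply: (no_chain rk x0) => i ik; [apply: xM|apply: xS].
    by rewrite (leq_trans ik) // ltnW.
  by rewrite (ltn_trans ik).
have [k /asboolP[x [x0 xM xS]] kmax] := ex_maxnP chain0 chain_bound.
have [Mk xk0] := xM k (leqnn k).
exists (x k) => // y My; apply: contrapT => Ayx.
have yn0 : y != 0 by apply/eqP => y0; apply: Ayx; rewrite y0 mul0r; apply: subring0.
suff /kmax : `[< chain k.+1 >] by rewrite ltnn.
apply/asboolP; exists (fun i => if (i <= k)%N then x i else y); split => // i.
  by rewrite leq_eqVlt => /orP[/eqP->|]; rewrite ?ltnn // ltnS => ik; rewrite ik; apply: xM.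
rewrite ltnS => ik; rewrite ik; move: ik; rewrite leq_eqVlt => /orP[/eqP->|ik].
  by rewrite ltnn; right; rewrite invf_div.
by rewrite ik; apply: xS.
Qed.

Let unit x := x != 0 /\ A x /\ A x^-1.

(** If pi^k divides z, then z, pi^(k-1), pi^(k-2), ... is a chain, so k is bounded. For the largest
    k the quotient is a unit, as a nonunit would be divisible by pi once more. *)
Let max_exponent pi z : M pi -> pi != 0 -> (forall y, M y -> A (y / pi)) ->
  A z -> z != 0 -> exists k : nat, unit (z / pi ^+ k).
Proof.
move=> Mpi pi0 gen Az zn0.
have [Az'|Az'] := pselect (A z^-1); first by exists 0%N; rewrite expr0 divr1.
have Mz : M z by right.
have [n rk] := rank_finite FK (M_transcendental Mz zn0).
have ex0 : exists k, `[< A (z / pi ^+ k) >].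
  by exists 0%N; apply/asboolP; rewrite expr0 divr1.
have bound k : `[< A (z / pi ^+ k) >] -> (k <= n.+1)%N.
  move=> /asboolP Azk; rewrite leqNgt; apply/negP => nk.
  apply: (no_chain (x := fun i => if i is 0%N then z else pi ^+ (k - i)) rk) => //.
    case=> [//|i] ik; rewrite expf_neq0 //; split => //.
    have -> : (k - i.+1 = (k - i.+2).+1)%N by lia.
    by rewrite exprSr; apply: MM => //; apply: subringX => //; apply: MA.
  case=> [_|i ik].
    have -> : z / pi ^+ (k - 1) = z / pi ^+ k * pi; last exact: MM.
    have kE : k = (k - 1).+1 by lia.
    by rewrite {2}kE exprS; field; rewrite expf_neq0 ?pi0.
  have -> : pi ^+ (k - i.+1) / pi ^+ (k - i.+2) = pi => //.
  have -> : (k - i.+1 = (k - i.+2).+1)%N by lia.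
  by rewrite exprS mulfK // expf_neq0.
have [k /asboolP Ak kmax] := ex_maxnP ex0 bound.
exists k; split; first by rewrite mulf_neq0 // invr_eq0 expf_neq0.
split=> //; apply: contrapT => nA.
have /gen : M (z / pi ^+ k) by right.
rewrite -mulrA -invfM -exprSr => Ak1.
by have := kmax k.+1 (asboolT Ak1); rewrite ltnn.
Qed.

Let unit_exponent pi z : M pi -> pi != 0 -> (forall y, M y -> A (y / pi)) ->
  z != 0 -> exists k : int, unit (z / pi ^ k).
Proof.
move=> Mpi pi0 gen zn0; case: (valA z) => Az.
  by have [k uk] := max_exponent Mpi pi0 gen Az zn0; exists k%:Z.
have [|k [un0 [Au Au']]] := max_exponent Mpi pi0 gen Az; first by rewrite invr_eq0.
exists (- k%:Z); have -> : z / pi ^ (- k%:Z) = (z^-1 / pi ^+ k)^-1.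
  by rewrite -invr_expz invrK invfM !invrK.
by split; rewrite ?invr_eq0 // invrK.
Qed.

Lemma place_of_valuation_ring t : t != 0 -> A t -> ~ A t^-1 ->
  exists v, place_valuation iota v /\ forall x, A x <-> vge v 0 x.
Proof.
move=> tn0 At At'; have Mt : M t by right.
have [pi [Mpi pi0] gen] := uniformizer Mt tn0.
have /choice[w wP] : forall z, exists k : int, z != 0 -> unit (z / pi ^ k).
  move=> z; have [->|zn0] := eqVneq z 0; first by exists 0.
  by have [k uk] := unit_exponent Mpi pi0 gen zn0; exists k.
have pin0 k : pi ^ k != 0 :> F by apply: expfz_neq0.
(* This turns the ultrametric inequality into closure of [A] under addition. *)
have wA z k : z != 0 -> (k <= w z)%R <-> A (z / pi ^ k).
  move=> zn0; have [un0 [Au Au']] := wP z zn0; split.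
    move=> kw; have -> : z / pi ^ k = z / pi ^ (w z) * pi ^ (w z - k).
      by rewrite expfzDr // -[pi ^ (- k)]invr_expz; field; rewrite !pin0.
    apply: AM => //; have -> : w z - k = `|w z - k|%N :> int by lia.
    by apply: subringX => //; apply: MA.
  move=> Azk; rewrite leNgt; apply/negP => wk; apply: M1.
  have -> : 1 = z / pi ^ k * (z / pi ^ w z)^-1 * pi ^ (k - w z).
    by rewrite expfzDr // -[pi ^ (- _)]invr_expz; field; rewrite !pin0 zn0.
  have -> : k - w z = `|k - w z|.-1.+1%N :> int by lia.
  rewrite -exprnP exprSr mulrA; apply: MM => //; apply: AM; first exact: AM.
  by apply: subringX => //; apply: MA.
have wE z k : z != 0 -> unit (z / pi ^ k) -> w z = k.
  move=> zn0 [un0 [Au Au']]; apply: le_anti; rewrite (wA z k zn0).2 // andbT.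
  rewrite leNgt; apply/negP => kw; apply: M1.
  have /(wA z _ zn0) Ak1 : (k + 1 <= w z)%R by lia.
  have -> : 1 = z / pi ^ (k + 1) * (z / pi ^ k)^-1 * pi.
    by rewrite expfzDr // expr1z; field; rewrite pin0 zn0 pi0.
  by apply: MM => //; apply: AM.
pose v z := if z == 0 then +oo%E else (w z)%:E.
have v0 : v 0 = +oo%E by rewrite /v eqxx.
have vE z : z != 0 -> v z = (w z)%:E by rewrite /v => /negPf->.
have dv : discrete_valuation v.
  split.
  - apply/seteqP; split=> [_ [z _ <-]|[k| |] //= _].
    + by rewrite /v /=; case: (z == 0).
    + exists (pi ^ k) => //; rewrite vE //; congr EFin; apply: wE => //.
      by rewrite divff //; split; rewrite ?invr1 ?oner_neq0.
    + by exists 0.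
  - move=> x; split=> [|->//]; rewrite /v; by case: eqP.
  - move=> x y; have [->|xn0] := eqVneq x 0.
      by rewrite mul0r v0 /v; case: eqP.
    have [->|yn0] := eqVneq y 0; first by rewrite mulr0 v0 /v; case: eqP.
    rewrite !vE ?mulf_neq0 // -EFinD; congr EFin; apply: wE; first by rewrite mulf_neq0.
    have [xu [Ax Ax']] := wP x xn0; have [yu [Ay Ay']] := wP y yn0.
    have -> : x * y / pi ^ (w x + w y) = (x / pi ^ w x) * (y / pi ^ w y).
      by rewrite expfzDr //; field; rewrite !pin0.
    split; first by rewrite mulf_neq0.
    by rewrite invfM; split; apply: AM.
  - move=> x y; have [->|xn0] := eqVneq x 0; first by rewrite add0r ge_min lexx orbT.
    have [->|yn0] := eqVneq y 0; first by rewrite addr0 ge_min lexx.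
    have [->|xyn0] := eqVneq (x + y) 0; first by rewrite v0 leey.
    rewrite !vE // -EFin_min lee_fin wA // mulrDl.
    by apply: subringD => //; apply/wA => //; rewrite ge_min lexx ?orbT.
have Av x : A x <-> vge v 0 x.
  have [->|xn0] := eqVneq x 0; first by split=> _; [exact: vge0|exact: subring0].
  by rewrite /vge vE // lee_fin wA // expr0z divr1.
exists v; split => //; split=> // c; apply/Av/KA; by exists c.
Qed.

End DiscreteValuationRing.

(** The valuation ring is chosen to contain z^-1 but not z. *)
Lemma pole_exists (K F : fieldType) (iota : {rmorphism K -> F}) z :
  function_field iota -> transcendental iota z ->
  exists v, place_valuation iota v /\ ~ vge v 0 z.
Proof.
move=> FK z_tr; have zn0 : z != 0.
  by apply/eqP => z0; apply: z_tr; rewrite z0; apply: algebraic0.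
have t_tr : transcendental iota z^-1 by move=> /algebraic_inv; rewrite invrK.
have [A [ringA KA valA At At']] := exists_valuation_ring t_tr.
have [|v [Kv vA]] := place_of_valuation_ring FK ringA KA valA _ At At'.
  by rewrite invr_eq0.
by exists v; split => //; rewrite -vA; rewrite invrK in At'.
Qed.

(** * Weak approximation *)

Section PlaceValuations.
Context (K F : fieldType) (iota : {rmorphism K -> F}).

Lemma vge_subring v : discrete_valuation v -> is_subring [set x : F | vge v 0 x].
Proof.
move=> dv; split; [exact: vge1|by move=> x y; apply: vgeB|move=> x y xv yv].
by have := vgeM dv xv yv; rewrite addr0.
Qed.

Lemma vge_mul0 v k x y : discrete_valuation v -> @vge F v 0 x -> vge v k y -> vge v k (x * y).
Proof. by move=> dv xv yv; have := vgeM dv xv yv; rewrite add0r. Qed.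

Lemma vge_bound v x : discrete_valuation v -> exists b : nat, @vge F v (- b%:Z) x.
Proof.
move=> dv; have [->|xn0] := eqVneq x 0; first by exists 0%N; apply: vge0.
have [k [kx _]] := vge_exact dv xn0; exists `|k|%N.
by apply: vge_le kx; lia.
Qed.

Lemma vge_ev v t p : place_valuation iota v -> vge v 0 t -> vge v 0 (ev iota t p).
Proof.
move=> [dv Kv] tv; apply: (subring_horner (vge_subring dv)) => // i.
by rewrite coef_map; apply: Kv.
Qed.

Lemma vge_ev0 v t p : place_valuation iota v -> vge v 1 t ->
  vge v 1 (ev iota t p) -> p`_0 = 0.
Proof.
move=> Kv tv pv; have [dv vK] := Kv; have [q qE] := ev_split iota t p.
have : vge v 1 (iota p`_0).
  have -> : iota p`_0 = ev iota t p - ev iota t q * t by rewrite qE; ring.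
  apply: vgeB => //; apply: vge_mul0 => //; apply: vge_ev => //.
  exact: vge_le tv.
have [//|p0] := eqVneq p`_0 0; move=> /(vge_mul0 dv (vK (p`_0)^-1)).
by rewrite fmorphV mulVf ?fmorph_eq0 // => /(not_vge1 dv).
Qed.

Lemma vge_algebraic v c : place_valuation iota v -> algebraicOver iota c ->
  c != 0 -> vge v 0 c /\ ~ vge v 1 c.
Proof.
move=> Kv; have [dv vK] := Kv.
have main d : algebraicOver iota d -> d != 0 -> vge v 0 d.
  move=> d_alg dn0; apply: contrapT => dv0.
  have := vgeV dv dv0; rewrite subr0 => dv1; apply: dv0.
  have [h] := algebraic_inverse (algebraic_inv d_alg) (invr_neq0 dn0).
  rewrite invrK => ->; apply: (vge_ev h) => //; exact: vge_le dv1.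
move=> c_alg cn0; split; first exact: main.
have := main _ (algebraic_inv c_alg) (invr_neq0 cn0) => c' /(vge_mul0 dv c').
by rewrite mulVf // => /(not_vge1 dv).
Qed.

(** A discrete valuation ring is maximal among proper subrings: if v x > 0 but w x <= 0, then for a
    uniformizer y of w and b large, y^-1 x^b is integral at v although w(y^-1 x^b) < 0. *)
Lemma center_sub v w : discrete_valuation v -> discrete_valuation w ->
  (forall x : F, vge v 0 x -> vge w 0 x) -> center v = center w.
Proof.
move=> dv dw vw; apply/seteqP; split=> x; rewrite /center /= => xv; last first.
  have [->|xn0] := eqVneq x 0; first exact: vge0.
  apply: contrapT => /(vgeV dv); rewrite subrr => /vw/(vgeM dw xv).
  by rewrite mulfV // addr0 => /(not_vge1 dw).
apply: contrapT => xw; have xw' := vgeV dw xw; rewrite subrr in xw'.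
have [y [yw y2]] := dval_uniformizer dw.
have yn0 : y != 0 by apply/eqP => y0; apply: y2; rewrite y0; apply: vge0.
have [b yb] := vge_bound y^-1 dv.
have /vw : vge v 0 (y^-1 * x ^+ b).
  by have := vgeM dv yb (vgeX dv b xv); apply: vge_le; lia.
move=> /(vgeM dw yw); rewrite mulVKf // => /(vgeM dw (vge0X dw b xw')).
rewrite exprVn mulVf ?addr0 ?add0r; first by move/(not_vge1 dw).
by rewrite expf_neq0 //; apply/eqP => x0; apply: xw; rewrite x0; apply: vge0.
Qed.

Lemma vge_center v w x : discrete_valuation v -> discrete_valuation w ->
  center v = center w -> @vge F v 0 x -> vge w 0 x.
Proof.
move=> dv dw vw xv; apply: contrapT => xw.
have : center w x^-1 by have := vgeV dw xw; rewrite subr0.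
rewrite -vw => /(vge_mul0 dv xv); rewrite mulfV; first by move/(not_vge1 dv).
by apply/eqP => x0; apply: xw; rewrite x0; apply: vge0.
Qed.

Lemma separate2 v w : discrete_valuation v -> discrete_valuation w ->
  center v <> center w -> exists y : F, vge v 1 y /\ ~ vge w 0 y.
Proof.
move=> dv dw vw.
have [u [uv uw]] : exists u : F, vge v 0 u /\ ~ vge w 0 u.
  apply: contrapT => nu; apply: vw; apply: center_sub => // x xv.
  by apply: contrapT => xw; apply: nu; exists x.
have [z [zw zv]] : exists z : F, vge w 0 z /\ ~ vge v 0 z.
  apply: contrapT => nz; apply: vw; apply/esym/center_sub => // x xw.
  by apply: contrapT => xv; apply: nz; exists x.
have zn0 : z != 0 by apply/eqP => z0; apply: zv; rewrite z0; apply: vge0.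
exists (u / z); split.
  by apply: vge_mul0 => //; have := vgeV dv zv; rewrite subr0.
by move=> /(vge_mul0 dw zw); rewrite mulrCA mulfV // mulr1.
Qed.

Lemma separate v (w : nat -> F -> \bar int) n : discrete_valuation v ->
  (forall i, (i < n)%N -> discrete_valuation (w i)) ->
  exists y, vge v 1 y /\ forall i, (i < n)%N -> center (w i) <> center v -> ~ vge (w i) 0 y.
Proof.
move=> dv; elim: n => [|n IH] dw.
  by exists 0; split=> //; apply: vge0.
have [|y [yv yw]] := IH; first by move=> i /ltnW; apply: dw.
have [wv|wv] := pselect (center (w n) = center v).
  exists y; split=> // i; rewrite ltnS leq_eqVlt => /orP[/eqP->|]; by [|apply: yw].
have [z [zv zw]] := separate2 dv (dw n (ltnSn n)) (not_eq_sym wv).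
(* Where z has a pole, z^(b+1) outweighs y; where it has none, y already has a pole and the sum
   keeps it. *)
have [b yb] : exists b : nat, forall i : 'I_n.+1, vge (w i) (- b%:Z) y.
  have /choice[b bP] := fun i : 'I_n.+1 => vge_bound y (dw i (ltn_ord i)).
  exists (\max_i b i)%N => i; apply: vge_le (bP i).
  by rewrite lerN2 lez_nat; apply: (leq_bigmax i).
have zn0 : z != 0 by apply/eqP => z0; apply: zw; rewrite z0; apply: vge0; apply: dw.
exists (y + z ^+ b.+1); split.
  apply: vgeD => //; have := vgeX dv b.+1 zv; apply: vge_le; lia.
move=> i ilt wiv; have dwi := dw i ilt.
have [zi|zi] := pselect (vge (w i) 0 z).
  apply: vgeDN => //; last exact: vge0X.
  move: ilt; rewrite ltnS leq_eqVlt => /orP[/eqP e|il]; last exact: yw.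
  by move: zi; rewrite e => /zw.
suff : ~ vge (w i) (- b%:Z) (y + z ^+ b.+1).
  by apply: contra_not; apply: vge_le; lia.
rewrite addrC; apply: vgeDN (yb (Ordinal ilt)) => // zb.
have := vgeV dwi zi; rewrite subr0 => /(vgeX dwi b.+1) /(vgeM dwi zb).
rewrite exprVn mulfV ?expf_neq0 // => h; apply: (not_vge1 dwi).
by apply: vge_le h; lia.
Qed.

(** If y vanishes at v and has poles at the w_i, then y^N / (1 + y^N) is close to 0 at v and close
    to 1 at the w_i. *)
Lemma approximate v (w : nat -> F -> \bar int) n (N : nat) : (0 < N)%N ->
  discrete_valuation v -> (forall i, (i < n)%N -> discrete_valuation (w i)) ->
  exists y, vge v N y /\
    forall i, (i < n)%N -> center (w i) <> center v -> vge (w i) N (1 - y).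
Proof.
move=> N0 dv dw; have [y [yv yw]] := separate dv dw.
have yN : vge v N (y ^+ N) by have := vgeX dv N yv; apply: vge_le; lia.
have y1 : ~ vge v 1 (1 + y ^+ N).
  by apply: (vgeDN dv (not_vge1 dv)); apply: vge_le yN; lia.
have yn0 : 1 + y ^+ N != 0 by apply/eqP => y0; apply: y1; rewrite y0; apply: vge0.
exists (y ^+ N / (1 + y ^+ N)); split.
  by rewrite mulrC; apply: vge_mul0 => //; have := vgeV dv y1; rewrite subrr.
move=> i il wiv; have yi := yw i il wiv; have dwi := dw i il.
have y0 : y != 0 by apply/eqP => y0; apply: yi; rewrite y0; apply: vge0.
have := vgeV dwi yi; rewrite subr0 => /(vgeX dwi N) yi'.
have {}yi' : vge (w i) N (y ^+ N)^-1 by rewrite -exprVn; apply: vge_le yi'; lia.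
have z1 : ~ vge (w i) 1 (1 + (y ^+ N)^-1).
  by apply: (vgeDN dwi (not_vge1 dwi)); apply: vge_le yi'; lia.
have zn0 : 1 + (y ^+ N)^-1 != 0 by apply/eqP => z0; apply: z1; rewrite z0; apply: vge0.
have -> : 1 - y ^+ N / (1 + y ^+ N) = (1 + (y ^+ N)^-1)^-1 * (y ^+ N)^-1.
  field; rewrite ?expf_neq0 ?yn0 //=.
  have -> : y ^+ N + 1 = (1 + (y ^+ N)^-1) * y ^+ N by rewrite mulrDl mulVf ?expf_neq0 // mul1r.
  by rewrite mulf_neq0 ?expf_neq0.
by apply: vge_mul0 => //; have := vgeV dwi z1; rewrite subrr.
Qed.

End PlaceValuations.

(** * A weak form of the Riemann inequality *)

Section Codimension.
Context (K F : fieldType) (iota : {rmorphism K -> F}).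

Definition is_subspace (V : set F) :=
  [/\ V 0, forall x y, V x -> V y -> V (x + y) & forall c x, V x -> V (iota c * x)].

Lemma subspace_sum V (I : finType) (c : I -> K) (f : I -> F) :
  is_subspace V -> (forall i, V (f i)) -> V (\sum_i iota (c i) * f i).
Proof. by move=> [V0 VD VZ] Vf; elim/big_ind: _ => // i _; apply: VZ. Qed.

Definition dependent_mod (V W : set F) d := forall f : 'I_d -> F, (forall i, V (f i)) ->
  exists2 c : 'I_d -> K, (exists i, c i != 0) & W (\sum_i iota (c i) * f i).

Definition codim_le (V W : set F) d := exists I : finType, (#|I| <= d)%N /\
  exists g : I -> F, forall f, V f -> exists c : I -> K, W (f - \sum_i iota (c i) * g i).

Lemma codim_le_trans V W U d e :
  codim_le V W d -> codim_le W U e -> codim_le V U (d + e).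
Proof.
move=> [I [Id [g gP]]] [J [Je [h hP]]]; exists (I + J)%type.
split; first by rewrite card_sum leq_add.
exists (fun s => match s with inl i => g i | inr j => h j end) => f /gP[c /hP[b Ub]].
exists (fun s => match s with inl i => c i | inr j => b j end).
by rewrite big_sumType /= opprD addrA.
Qed.

(** Otherwise a family in V independent modulo W could be extended step by step to length d + 1. *)
Lemma dependent_codim V W d : is_subspace V -> is_subspace W ->
  dependent_mod V W d.+1 -> codim_le V W d.
Proof.
move=> subV subW dep; have [W0 WD WZ] := subW; apply: contrapT => ncod.
pose indep k := exists g : 'I_k -> F, (forall i, V (g i)) /\
  forall c : 'I_k -> K, W (\sum_i iota (c i) * g i) -> forall i, c i = 0.
suff : indep d.+1.
  case=> g [Vg gW]; have [c [i ci] /gW c0] := dep g Vg.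
  by rewrite c0 eqxx in ci.
suff ind k : (k <= d.+1)%N -> indep k by apply: ind.
elim: k => [|k IH] kd; first by exists (fun=> 0); split=> [[]|c _ []].
have [g [Vg gW]] := IH (ltnW kd).
have [f [Vf fW]] : exists f, V f /\ forall c : 'I_k -> K, ~ W (f - \sum_i iota (c i) * g i).
  apply: contrapT => nf; apply: ncod; exists 'I_k; split; first by rewrite card_ord.
  exists g => f Vf; apply: contrapT => nc; apply: nf; exists f; split => // c Wc.
  by apply: nc; exists c.
pose g' (j : 'I_k.+1) := if unlift ord_max j is Some i then g i else f.
have g'w i : g' (widen_ord (leqnSn k) i) = g i.
  rewrite /g' (_ : widen_ord _ i = lift ord_max i) ?liftK //.
  by apply: val_inj; rewrite /= /bump leqNgt ltn_ord.
have g'm : g' ord_max = f by rewrite /g' unlift_none.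
exists g'; split=> [j|c].
  by rewrite /g'; case: unliftP.
rewrite big_ord_recr /= g'm => Wc.
have cm : c ord_max = 0.
  have [//|cmn0] := eqVneq (c ord_max) 0.
  case: (fW (fun i => - ((c ord_max)^-1 * c (widen_ord (leqnSn k) i)))).
  move: (WZ (c ord_max)^-1 _ Wc); rewrite mulrDr mulrA -rmorphM mulVf // rmorph1 mul1r.
  rewrite addrC mulr_sumr -sumrN; congr (W (_ + _)); apply: eq_bigr => i _.
  by rewrite g'w rmorphN rmorphM mulNr opprK mulrA.
move: Wc; rewrite cm rmorph0 mul0r addr0.
under eq_bigr => i _ do rewrite g'w.
move=> /gW c0 j; case: (unliftP ord_max j) => [i ->|->//].
rewrite -[RHS](c0 i); congr c.
by apply: val_inj; rewrite /= /bump leqNgt ltn_ord.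
Qed.

Lemma codim_zero_bound V d (I : finType) (f : I -> F) :
  codim_le V [set 0] d -> (forall i, V (f i)) ->
  (forall c : I -> K, \sum_i iota (c i) * f i = 0 -> forall i, c i = 0) -> (#|I| <= d)%N.
Proof.
move=> [J [Jd [g gP]]] Vf find; rewrite leqNgt; apply/negP => dI.
have /choice[c cP] := fun i => gP _ (Vf i).
have fE i : f i = \sum_j iota (c i j) * g j by apply/eqP; rewrite -subr_eq0; apply/eqP/cP.
have [|r [i ri] rc] := @lin_dep _ _ _ c; first exact: leq_ltn_trans Jd dI.
have /find/(_ i)/eqP : \sum_i iota (r i) * f i = 0; last by rewrite (negPf ri).
under eq_bigr => k _ do rewrite fE mulr_sumr.
rewrite exchange_big big1 // => j _.
transitivity (iota (\sum_i r i * c i j) * g j); last by rewrite rc rmorph0 mul0r.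
rewrite rmorph_sum mulr_suml; apply: eq_bigr => k _.
by rewrite rmorphM mulrA.
Qed.

End Codimension.

Section RankLemmas.
Context (K F : fieldType) (iota : {rmorphism K -> F}).

Lemma dependent_inv t (I : finType) (f : I -> F) : t != 0 ->
  poly_dependent iota t f -> poly_dependent iota t^-1 f.
Proof.
move=> tn0 [p [i0 pi0] pf]; pose D := \max_i size (p i).
have pD i : (size (p i) <= D)%N by apply: (leq_bigmax i).
(* Coefficients reversed within length D, hence degree below D: t^D times the value at t^-1 is t
   times the value of [p i] at t. *)
exists (fun i => \poly_(k < D) (p i)`_(D - k.+1)).
  exists i0; apply: contraNneq pi0 => /polyP q0; apply/eqP/polyP => k.
  rewrite coef0; have [kD|] := ltnP k D; last first.
    by move=> Dk; rewrite nth_default // (leq_trans (pD _)).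
  have := q0 (D - k.+1)%N; rewrite coef0 coef_poly ifT; last by lia.
  by rewrite (_ : D - (D - k.+1).+1 = k)%N //; lia.
have e i : t ^+ D * ev iota t^-1 (\poly_(k < D) (p i)`_(D - k.+1)) = t * ev iota t (p i).
  rewrite evE [map_poly _ _](_ : _ = \poly_(k < D) iota (p i)`_(D - k.+1)); last first.
    by apply/polyP => k; rewrite coef_map !coef_poly; case: ifP => // _; apply: rmorph0.
  rewrite horner_poly evE (@horner_coef_wide _ D) ?size_map_poly //.
  rewrite !mulr_sumr (reindex_inj rev_ord_inj) /=; apply: eq_bigr => k _.
  have -> : (D - (D - k.+1).+1 = k)%N by have := ltn_ord k; lia.
  rewrite coef_map exprVn.
  have -> : t ^+ D = t * t ^+ k * t ^+ (D - k.+1).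
    by rewrite -exprS -exprD subnKC.
  by rewrite mulrCA mulfK ?expf_neq0 // mulrA [RHS]mulrCA [in RHS]mulrA.
apply: (mulfI (expf_neq0 D tn0)); rewrite mulr0 mulr_sumr.
rewrite -[RHS](mulr0 t) -[in RHS]pf mulr_sumr; apply: eq_bigr => i _.
by rewrite !mulrA; congr (_ * _); apply: e.
Qed.

(** The leading coefficient P of a relation of degree j for y over K[x] makes z = P y integral over
    K[x]. This is checked at each v: if z had a pole, the relation times P^(j-1) / z^j would read 1
    plus terms of positive value. *)
Lemma integral_multiple x y : function_field iota -> transcendental iota x ->
  exists q, q != 0 /\ forall v, place_valuation iota v -> vge v 0 x ->
    vge v 0 (ev iota x q * y).
Proof.
move=> FK x_tr; have [n rk] := rank_finite FK x_tr.
have [p [i0 pi0] py] := rk (fun i => y ^+ i).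
pose j := [arg max_(i > i0 | p i != 0) (i : nat)].
have [pj0 jmax] : p j != 0 /\ forall i, p i != 0 -> (i <= j)%N.
  by rewrite /j; case: arg_maxnP => // k pk kmax.
exists (p j); split => // v Kv xv; have [dv vK] := Kv.
set z := ev iota x (p j) * y; apply: contrapT => zv.
have zn0 : z != 0 by apply/eqP => z0; apply: zv; rewrite z0; apply: vge0.
have pn0 : ev iota x (p j) != 0 by rewrite ev_eq0.
have yE : y = z / ev iota x (p j) by rewrite /z mulrC mulKf.
have := vgeV dv zv; rewrite subr0 => zv'.
have j0 : (0 < j)%N.
  rewrite lt0n; apply/eqP => j0; have := py; rewrite (bigD1 j) //= big1 => [|i ij].
    by move/eqP; rewrite addr0 mulf_eq0 (negPf pn0) j0 expr0 oner_eq0.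
  have [->|/jmax] := eqVneq (p i) 0; first by rewrite rmorph0 mul0r.
  by rewrite j0 leqn0 -j0 -val_eqE in ij *; rewrite (negPf ij).
set P := ev iota x (p j) in pn0 yE *.
have Pv : vge v 0 P by apply: vge_ev.
have E : P ^+ j.-1 / z ^+ j * \sum_(i < n.+1) ev iota x (p i) * y ^+ i = 0.
  by rewrite py mulr0.
apply: (not_vge1 dv); move: E; rewrite (bigD1 j) //= mulrDr.
have -> : P ^+ j.-1 / z ^+ j * (P * y ^+ j) = 1.
  rewrite yE expr_div_n; have -> : P ^+ j = P * P ^+ j.-1 by rewrite -exprS prednK.
  by field; rewrite pn0 !expf_neq0.
move=> /eqP; rewrite addr_eq0 => /eqP ->; apply: vgeN => //; rewrite mulr_sumr.
apply: vge_sum => // i ij.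
have [->|/jmax] := eqVneq (p i) 0; first by rewrite rmorph0 mul0r mulr0; apply: vge0.
rewrite leq_eqVlt val_eqE (negPf ij) /= => lij.
have -> : P ^+ j.-1 / z ^+ j * (ev iota x (p i) * y ^+ i)
    = ev iota x (p i) * (P ^+ (j.-1 - i) * z^-1 ^+ (j - i)).
  have -> : P ^+ j.-1 = P ^+ (j.-1 - i) * P ^+ i by rewrite -exprD subnK //; lia.
  have -> : z ^+ j = z ^+ (j - i) * z ^+ i by rewrite -exprD subnK // ltnW.
  rewrite yE expr_div_n exprVn; field; by rewrite !expf_neq0.
do 2 (apply: vge_mul0 => //; first by [apply: vge_ev|apply: vge0X]).
have := vgeX dv (j - i) zv'; apply: vge_le; lia.
Qed.

End RankLemmas.

Section Riemann.
Context (K F : fieldType) (iota : {rmorphism K -> F}).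
Context (FK : function_field iota).

(** [n.+1] is [F : K(x)]; it is positive because 1 alone is independent. *)
Lemma exact_rank x : transcendental iota x ->
  exists n, rank_le iota x n.+1 /\ exists y : 'I_n.+1 -> F, ~ poly_dependent iota x y.
Proof.
move=> x_tr; have [n0 rk0] := rank_finite FK x_tr.
have ex : exists n, `[< rank_le iota x n >] by exists n0; apply/asboolP.
case: (ex_minnP ex) => -[|n] /asboolP rk nmin.
  have [p [i pi]] := rk (fun=> 1); rewrite big_ord1 mulr1 => /eqP.
  by rewrite ev_eq0 // => /eqP p0; rewrite (ord1 i) p0 eqxx in pi.
exists n; split=> //; apply: contrapT => ny.
suff /nmin : `[< rank_le iota x n >] by rewrite ltnn.
by apply/asboolP => y; apply: contrapT => yd; apply: ny; exists y.
Qed.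

Definition zeros_of t (w : nat -> F -> \bar int) k :=
  forall i, (i < k)%N -> place_valuation iota (w i) /\ vge (w i) 1 t.

(** Approximation gives z_i that vanish at the other w_j but not at w_i. In a relation over K[t]
    reduced at one w_i only the i-th term survives, so the z_i are independent over K(t). *)
Lemma few_zeros t w k n : t != 0 -> rank_le iota t n -> zeros_of t w k ->
  (forall i j, (i < j)%N -> (j < k)%N -> center (w i) <> center (w j)) -> (k <= n)%N.
Proof.
move=> tn0 rk wt wdist; rewrite leqNgt; apply/negP => nk.
have lt (i : 'I_n.+1) : (i < k)%N by apply: leq_trans nk.
have dw i : (i < k)%N -> discrete_valuation (w i) by move=> /wt[[]].
have /choice[z zP] (i : 'I_n.+1) : exists z, ~ vge (w i) 1 z /\
    forall j, (j < k)%N -> j != i -> vge (w j) 1 z.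
  have [y [yi yj]] := approximate (N := 1) isT (dw i (lt i)) dw.
  exists (1 - y); split.
    apply: (vgeDN (dw i (lt i)) (not_vge1 (dw i (lt i)))); exact: (vgeN (dw i (lt i)) yi).
  move=> j jk ji; apply: yj => //; case: (ltngtP j i) ji => // h _.
    by apply: wdist.
  by apply/not_eq_sym/wdist.
have [p [i0 pi0] pz] := dependent_primitive tn0 (rk z).
have [Kw wt1] := wt i0 (lt i0); have [dw0 _] := Kw.
have [zi0 _] := zP i0; have zi0' := vgeV dw0 zi0; rewrite subrr in zi0'.
have zn0 : z i0 != 0 by apply/eqP => z0; apply: zi0; rewrite z0; apply: vge0.
suff : vge (w i0) 1 (ev iota t (p i0)) by move=> /(vge_ev0 Kw wt1)/eqP; rewrite (negPf pi0).
rewrite -[ev _ _ _](mulfK zn0) mulrC; apply: vge_mul0 => //.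
move: pz; rewrite (bigD1 i0) //= => /eqP; rewrite addr_eq0 => /eqP ->.
apply: vgeN => //; apply: vge_sum => // i ii0; apply: vge_mul0 => //.
  by apply: vge_ev => //; apply: vge_le wt1.
by have [_] := zP i; apply=> //; rewrite eq_sym.
Qed.

Lemma all_zeros t v0 n : t != 0 -> rank_le iota t n ->
  exists k w, zeros_of t w k /\ (forall i, (i < k)%N -> center (w i) <> center v0) /\
  forall u, place_valuation iota u -> vge u 1 t -> center u <> center v0 ->
    exists2 i, (i < k)%N & center u = center (w i).
Proof.
move=> tn0 rk.
pose Q k := exists w, [/\ zeros_of t w k, forall i, (i < k)%N -> center (w i) <> center v0 &
  forall i j, (i < j)%N -> (j < k)%N -> center (w i) <> center (w j)].
have Q0 : exists k, `[< Q k >] by exists 0%N; apply/asboolP; exists (fun=> v0); split.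
have Qn k : `[< Q k >] -> (k <= n)%N.
  by move=> /asboolP[w [wt _ wd]]; apply: few_zeros tn0 rk wt wd.
have [k /asboolP[w [wt w0 wd]] kmax] := ex_maxnP Q0 Qn.
exists k, w; split=> //; split=> // u Ku ut u0; apply: contrapT => nu.
suff /kmax : `[< Q k.+1 >] by rewrite ltnn.
apply/asboolP; exists (fun i => if (i < k)%N then w i else u); split=> [i|i|i j ij].
- by rewrite ltnS leq_eqVlt => /orP[/eqP->|ik]; rewrite ?ltnn // ik; apply: wt.
- by rewrite ltnS leq_eqVlt => /orP[/eqP->|ik]; rewrite ?ltnn // ik; apply: w0.
rewrite ltnS leq_eqVlt => /orP[/eqP jk|jk].
  rewrite jk ltnn -jk ij => e; apply: nu; exists i; rewrite // -jk //.
by rewrite jk (ltn_trans ij) //; apply: wd.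
Qed.

(* Let B be the semilocal ring of the w_i.  The elements b i * e below agree with
   the b i modulo tB but vanish at v0, so they remain independent over K(t) after
   adjoining 1 - e, which is in tB but not in the center of v0.  Hence B / tB has
   dimension strictly less than [F : K(t)]. *)
Lemma semilocal t v0 w k n : t != 0 -> rank_le iota t n.+1 ->
  place_valuation iota v0 -> vge v0 1 t -> zeros_of t w k ->
  (forall i, (i < k)%N -> center (w i) <> center v0) ->
  forall b : 'I_n.+1 -> F, (forall i j, (j < k)%N -> vge (w j) 0 (b i)) ->
  exists2 c : 'I_n.+1 -> K, (exists i, c i != 0) &
    forall j, (j < k)%N -> vge (w j) 0 ((\sum_i iota (c i) * b i) / t).
Proof.
move=> tn0 rk Kv0 t0 wt w0 b bw; have [dv0 _] := Kv0.
have dw i : (i < k)%N -> discrete_valuation (w i) by move=> /wt[[]].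
have /choice[B1 B1P] : forall i : 'I_k, exists N : nat, vge (w i) (- N%:Z) t^-1.
  by move=> i; apply: vge_bound; apply: dw.
have /choice[B2 B2P] : forall i : 'I_n.+1, exists N : nat, vge v0 (- N%:Z) (b i).
  by move=> i; apply: vge_bound.
(* Large enough for b_i e to be integral at v0 and for (1 - e) / t to be integral at every w_j. *)
pose N := (\max_i B1 i + \max_i B2 i).+1.
have [e [e0 ew]] := approximate (N := N) isT dv0 dw.
have ev1 : ~ vge v0 1 (1 - e).
  apply: (vgeDN dv0 (not_vge1 dv0)); apply: (vgeN dv0); apply: vge_le e0; lia.
have bt i : vge v0 0 (b i * e).
  have := vgeM dv0 (B2P i) e0; apply: vge_le.
  have := leq_bigmax i : (B2 i <= _)%N; rewrite /N; lia.
have et j : (j < k)%N -> vge (w j) 0 ((1 - e) / t).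
  move=> jk; have := vgeM (dw j jk) (ew j jk (w0 j jk)) (B1P (Ordinal jk)); apply: vge_le.
  have := leq_bigmax (Ordinal jk) : (B1 (Ordinal jk) <= _)%N; rewrite /N; lia.
pose f (j : 'I_n.+2) := if unlift ord_max j is Some i then b i * e else 1 - e.
have fw i : f (widen_ord (leqnSn n.+1) i) = b i * e.
  rewrite /f (_ : widen_ord _ i = lift ord_max i) ?liftK //.
  by apply: val_inj; rewrite /= /bump leqNgt ltn_ord.
have fm : f ord_max = 1 - e by rewrite /f unlift_none.
have [p [i0 pi0]] := dependent_primitive tn0 (rk f).
rewrite big_ord_recr /= fm; under eq_bigr => i _ do rewrite fw.
set pw := fun i => p (widen_ord (leqnSn n.+1) i); set pm := p ord_max => pf.
have /choice[q qE] := fun i => ev_split iota t (pw i).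
exists (fun i => (pw i)`_0).
  (* If all these constant terms vanished, the relation would give pm(t) (1 - e) positive value at
     v0. As 1 - e is not in the center of v0, pm(0) would vanish too, against primitivity. *)
  apply: contrapT => nc; have pw0 i : (pw i)`_0 = 0.
    by apply/eqP/negPn/negP => ci; apply: nc; exists i.
  suff /(vge_ev0 Kv0 t0)/eqP pm0 : vge v0 1 (ev iota t pm).
    case: (unliftP ord_max i0) pi0 => [i ->|->]; last by rewrite pm0.
    rewrite (_ : lift ord_max i = widen_ord (leqnSn n.+1) i) ?pw0 ?eqxx //.
    by apply: val_inj; rewrite /= /bump leqNgt ltn_ord.
  have en0 : 1 - e != 0 by apply/eqP => z0; apply: ev1; rewrite z0; apply: vge0.
  have := vgeV dv0 ev1; rewrite subrr => ev1'.
  rewrite -[ev _ _ _](mulfK en0) mulrC; apply: vge_mul0 => //.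
  move: pf => /eqP; rewrite addrC addr_eq0 => /eqP ->; apply: vgeN => //.
  apply: vge_sum => // i _.
  rewrite qE pw0 rmorph0 add0r mulrAC mulrC; apply: vge_mul0 => //.
    by apply: vge_ev => //; apply: vge_le t0.
  by rewrite mulrC; apply: vge_mul0.
move=> j jk; have [[dj _] tj] := wt j jk; have [Kj _] := wt j jk.
have tj0 : vge (w j) 0 t by apply: vge_le tj.
have -> : (\sum_i iota (pw i)`_0 * b i) / t =
    (1 - e) / t * (\sum_i ev iota t (pw i) * b i - ev iota t pm)
    - \sum_i ev iota t (q i) * b i.
  have -> : \sum_i iota (pw i)`_0 * b i = \sum_i ev iota t (pw i) * b i
      - t * \sum_i ev iota t (q i) * b i.
    rewrite mulr_sumr -sumrB; apply: eq_bigr => i _; rewrite qE; ring.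
  have pfE : e * (\sum_i ev iota t (pw i) * b i) + ev iota t pm * (1 - e) = 0.
    rewrite -[RHS]pf mulr_sumr; congr (_ + _); apply: eq_bigr => i _; ring.
  move: (\sum_i ev iota t (pw i) * b i) (\sum_i ev iota t (q i) * b i) pfE => S T pfE.
  have {1}-> : S = (1 - e) * (S - ev iota t pm) + (e * S + ev iota t pm * (1 - e)) by ring.
  by rewrite pfE; field.
apply: vgeB => //; last first.
  apply: vge_sum => // i _; apply: vge_mul0 => //; last exact: bw.
  exact: vge_ev.
apply: vge_mul0 => //; first exact: et.
apply: vgeB => //; last exact: vge_ev.
apply: vge_sum => // i _; apply: vge_mul0 => //; last exact: bw.
exact: vge_ev.
Qed.

End Riemann.

(** * Functions with a single pole *)

Section PoleOnlyAt.
Context (K F : fieldType) (iota : {rmorphism K -> F}).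
Context (FK : function_field iota).

(** By contradiction: if functions without poles off v0 have none at v0, then [L m m] has dimension
    at most m n + n + 1, where n + 1 = [F : K(x)], yet the x^j y_i give (n + 1)(m - c + 1)
    independent elements of it. *)
Lemma pole_only_at v0 : place_valuation iota v0 ->
  exists f, (forall u, place_valuation iota u -> center u <> center v0 -> vge u 0 f) /\
    ~ vge v0 0 f.
Proof.
move=> Kv0; have [dv0 vK0] := Kv0; apply: contrapT => nf.
have {nf} nf f : (forall u, place_valuation iota u -> center u <> center v0 -> vge u 0 f) ->
    vge v0 0 f.
  by move=> fu; apply: contrapT => f0; apply: nf; exists f.
(* For a uniformizer t, the pole of x = t^-1 at v0 is simple, so x^j costs only order j there. *)
have [t [t1 t2]] := dval_uniformizer dv0.
have tn0 : t != 0 by apply/eqP => t0; apply: t2; rewrite t0; apply: vge0.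
have t_tr : transcendental iota t.
  by move=> t_alg; have [_] := vge_algebraic Kv0 t_alg tn0.
pose x := t^-1.
have x_tr : transcendental iota x by move=> /algebraic_inv; rewrite invrK.
have xn0 : x != 0 by rewrite invr_eq0.
have x1 : vge v0 (-1) x.
  have := vgeV dv0 t2; apply: vge_le; lia.
have [n [rkx [y0 y0ind]]] := exact_rank FK x_tr.
have rkt : rank_le iota t n.+1.
  by move=> f; rewrite -[t]invrK; apply: dependent_inv => //; apply: rkx.
have [k [w [wt [w0 wall]]]] := all_zeros v0 tn0 rkt.
have dw i : (i < k)%N -> discrete_valuation (w i) by move=> /wt[[]].
have t_w i : (i < k)%N -> vge (w i) 0 t by move=> /wt[_]; apply: vge_le.
(* L m b: poles only at the poles of x = t^-1, of order at most m at v0 and at most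
   b times the order of the pole of x elsewhere.  The dimension of L m m grows like
   m [F : K(x)], whereas L m 0 has codimension at most m ([F : K(x)] - 1) in it. *)
pose L (m b : nat) : set F := [set f | [/\
  forall u, place_valuation iota u -> ~ vge u 1 t -> vge u 0 f,
  vge v0 (- m%:Z) f & forall i, (i < k)%N -> vge (w i) 0 (f * t ^+ b)]].
have subL m b : is_subspace iota (L m b).
  split.
  - split=> [u [du _] _||i ik]; rewrite ?mul0r; apply: vge0 => //; exact: dw.
  - move=> f g [f1 f2 f3] [g1 g2 g3]; split=> [u Ku ut||i ik]; rewrite ?mulrDl.
    + by apply: vgeD; [case: Ku|apply: f1|apply: g1].
    + exact: vgeD.
    + by apply: vgeD; [exact: dw|apply: f3|apply: g3].
  move=> c f [f1 f2 f3]; split=> [u Ku ut||i ik]; rewrite -?mulrA.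
  - by apply: vge_mul0; [case: Ku|case: Ku|apply: f1].
  - exact: vge_mul0.
  - by apply: vge_mul0; [exact: dw|by have [[_]] := wt i ik|apply: f3].
have step m b : codim_le iota (L m b.+1) (L m b) n.
  apply: dependent_codim => // f Lf.
  have [|c c0 cw] := semilocal tn0 rkt Kv0 t1 wt w0 (b := fun i => f i * t ^+ b.+1).
    by move=> i j jk; have [_ _] := Lf i; apply.
  exists c => //; have [h1 h2 _] := subspace_sum c (subL m b.+1) Lf; split=> // i ik.
  have := cw i ik; congr (vge _ _ _).
  by rewrite !mulr_suml; apply: eq_bigr => j _; rewrite exprSr; field.
(* An element of [L m 0] can have a pole only at v0, hence has none by [nf]. Being then algebraic
   over K, it vanishes at v0 only if it is 0, so reduction at v0 is injective; its image has
   dimension at most [F : K(t)]. *)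
have last_step m : codim_le iota (L m 0%N) [set 0] n.+1.
  have subV1 : is_subspace iota [set f | L m 0%N f /\ vge v0 1 f].
    have [L0 LD LZ] := subL m 0%N; split.
    - by split=> //; apply: vge0.
    - by move=> f g [Lf f1] [Lg g1]; split; [apply: LD|apply: vgeD].
    - by move=> c f [Lf f1]; split; [apply: LZ|apply: vge_mul0].
  have -> : [set 0] = [set f | L m 0%N f /\ vge v0 1 f] :> set F.
    apply/seteqP; split=> [_ ->|f [[f1 f2 f3] fv]] /=.
      by have [] := subV1.
    apply: contrapT => /eqP fn0.
    have f_tr : transcendental iota f.
      by move=> f_alg; have [_] := vge_algebraic Kv0 f_alg fn0.
    have [u [Ku]] := pole_exists FK f_tr; apply; have [du _] := Ku.
    have [ut|ut] := pselect (vge u 1 t); last exact: f1.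
    have [uv|/(wall u Ku ut)[i ik uw]] := pselect (center u = center v0).
      by apply: (vge_center dv0 du) => //; apply: vge_le fv.
    apply: (vge_center (dw i ik) du) => //.
    by have := f3 i ik; rewrite expr0 mulr1.
  apply: dependent_codim => // f Lf.
  have fv0 i : vge v0 0 (f i).
    apply: nf => u Ku uv; have [f1 _ f3] := Lf i; have [du _] := Ku.
    have [ut|ut] := pselect (vge u 1 t); last exact: f1.
    have [j jk uw] := wall u Ku ut uv; apply: (vge_center (dw j jk) du) => //.
    by have := f3 j jk; rewrite expr0 mulr1.
  have [p [i0 pi0] pf] := dependent_primitive tn0 (rkt f).
  exists (fun i => (p i)`_0); first by exists i0.
  split; first exact: subspace_sum.
  have /choice[q qE] := fun i => ev_split iota t (p i).
  have -> : \sum_i iota (p i)`_0 * f i = - (t * \sum_i ev iota t (q i) * f i).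
    apply/eqP; rewrite -addr_eq0 mulr_sumr -big_split /=; apply/eqP; rewrite -[RHS]pf.
    by apply: eq_bigr => i _; rewrite qE; ring.
  apply: vgeN => //; rewrite mulrC; apply: vge_mul0 => //.
  apply: vge_sum => // i _; apply: vge_mul0 => //; apply: vge_ev => //.
  exact: vge_le t1.
have codim m b : codim_le iota (L m b) [set 0] (b * n + n.+1).
  elim: b => [|b IH]; first exact: last_step.
  by rewrite mulSn -addnA; apply: codim_le_trans IH; apply: step.
(* Scaled by polynomials in x, the basis over K(x) has poles only where x has. *)
have /choice[q qP] := fun i => integral_multiple (y0 i) FK x_tr.
pose y i := ev iota x (q i) * y0 i.
have /choice[B1 B1P] := fun i => vge_bound (y i) dv0.
have /choice[B2 B2P] : forall ij : 'I_n.+1 * 'I_k, exists b : nat, vge (w ij.2) (- b%:Z) (y ij.1).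
  by move=> ij; apply: vge_bound; apply: dw.
pose c := (\max_i B1 i + \max_ij B2 ij)%N.
(* The inequality (n + 1)(m - c + 1) > m n + n + 1 amounts to m > (n + 1) c. *)
pose m := (n.+1 * c).+1.
pose f (ij : 'I_n.+1 * 'I_(m - c).+1) := x ^+ ij.2 * y ij.1.
have cm : (c <= m)%N by rewrite /m; nia.
have Lf ij : L m m (f ij).
  case: ij => i [j /= jm]; split=> [u Ku ut||l lk]; rewrite /f /=.
  - have [du _] := Ku; have xu : vge u 0 x by have := vgeV du ut; rewrite subrr.
    by apply: vge_mul0 => //; [apply: vge0X|have [_] := qP i; apply].
  - have := vgeM dv0 (vgeX dv0 j x1) (B1P i); apply: vge_le.
    have := leq_bigmax i : (B1 i <= _)%N; lia.
  have -> : x ^+ j * y i * t ^+ m = t ^+ (m - c - j) * (t ^+ c * y i).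
    have {1}-> : m = (m - c - j + c + j)%N by lia.
    by rewrite !exprD /x exprVn; field; rewrite expf_neq0.
  apply: vge_mul0; [exact: dw|exact/vge0X/t_w/lk/dw|].
  have [dl tl] : discrete_valuation (w l) /\ vge (w l) 1 t.
    by split; [apply: dw|case: (wt l lk)].
  have := vgeM dl (vgeX dl c tl) (B2P (i, Ordinal lk)); apply: vge_le.
  have := leq_bigmax (i, Ordinal lk) : (B2 (i, Ordinal lk) <= _)%N; lia.
have := codim_zero_bound (codim m m) Lf.
rewrite card_prod !card_ord => h.
suff /h : forall a : 'I_n.+1 * 'I_(m - c).+1 -> K,
    \sum_i iota (a i) * f i = 0 -> forall i, a i = 0 by rewrite /m; nia.
move=> a a0 [i j]; apply: contrapT => /eqP aij; apply: y0ind.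
exists (fun i => \poly_(j < (m - c).+1) a (i, inord j) * q i).
  exists i; rewrite mulf_neq0 //; last by case: (qP i).
  apply: contraNneq aij => /polyP/(_ j); rewrite coef0 coef_poly ltn_ord.
  by rewrite inord_val => ->.
rewrite -[RHS]a0; transitivity (\sum_i \sum_j iota (a (i, j)) * (x ^+ j * y i)); last first.
  by rewrite pair_bigA; apply: eq_bigr => -[].
apply: eq_bigr => i' _; rewrite rmorphM /= -mulrA -/(y i') poly_def rmorph_sum mulr_suml.
apply: eq_bigr => j' _; rewrite -mul_polyC rmorphM /= evC evXn inord_val.
by rewrite -[LHS]mulrA.
Qed.

End PoleOnlyAt.

(** * The group of S-units *)

Section UnitGroup.
Context (K F : fieldType) (iota : {rmorphism K -> F}).

Lemma finite_places (S : set (set F)) : finite_set S ->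
  (forall P, S P -> is_place iota P) ->
  exists k (v : nat -> F -> \bar int), (forall i, (i < k)%N -> place_valuation iota (v i)) /\
    forall P, S P <-> exists2 i, (i < k)%N & P = center (v i).
Proof.
move=> /finite_seqP[s ->] sP.
have /choice[v vP] : forall i, exists v : F -> \bar int, (i < size s)%N ->
    place_valuation iota v /\ nth set0 s i = center v.
  move=> i; have [il|_] := ltnP i (size s); last by exists (fun=> 0%E).
  by have [v vP] := place_center (sP _ (mem_nth set0 il)); exists v.
exists (size s), v; split=> [i /vP[]//|P]; split=> [Ps|[i il ->]].
  by exists (index P s); rewrite ?index_mem // -(vP _ _).2 ?index_mem ?nth_index.
by rewrite -(vP i il).2 /=; apply: mem_nth.
Qed.

Definition ival (v : F -> \bar int) (x : F) : int := fine (v x).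

Lemma ivalE v x : discrete_valuation v -> x != 0 -> v x = (ival v x)%:E.
Proof. by move=> dv xn0; have [k vk] := dval_fin dv xn0; rewrite /ival vk. Qed.

Lemma ivalM v x y : discrete_valuation v -> x != 0 -> y != 0 ->
  ival v (x * y) = ival v x + ival v y.
Proof. by move=> dv xn0 yn0; rewrite {1}/ival (dvalM dv) !ivalE. Qed.

Lemma ivalV v x : discrete_valuation v -> x != 0 -> ival v x^-1 = - ival v x.
Proof. by move=> dv xn0; rewrite {1}/ival (dvalV dv (ivalE dv xn0)). Qed.

Lemma ivalX v x n : discrete_valuation v -> x != 0 -> ival v (x ^+ n) = ival v x *+ n.
Proof.
move=> dv xn0; elim: n => [|n IH]; first by rewrite expr0 mulr0n /ival dval_one.
by rewrite exprS mulrS ivalM ?IH // expf_neq0.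
Qed.

Lemma ivalXz v x (n : int) : discrete_valuation v -> x != 0 ->
  ival v (x ^ n) = ival v x * n.
Proof.
move=> dv xn0; case: n => n.
  by rewrite -exprnP ivalX // -mulr_natr natz.
rewrite NegzE -invr_expz ivalV ?expfz_neq0 // -exprnP ivalX // -mulr_natr natz; lia.
Qed.

Definition mul_group (U : set F) := [/\ U 1, forall x, U x -> x != 0,
  forall x y, U x -> U y -> U (x * y) & forall x, U x -> U x^-1].

Lemma mul_group_expz U x (n : int) : mul_group U -> U x -> U (x ^ n).
Proof.
move=> [U1 _ UM UV] Ux; have UX m : U (x ^+ m).
  by elim: m => // m IH; rewrite exprS; apply: UM.
by case: n => n; [apply: UX|rewrite NegzE -invr_expz; apply/UV/UX].
Qed.

(** On the elements of value 0 at the earlier places, the values at v_k form a subgroup of Z. If it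
    is nonzero, an element attaining the least positive value is the new generator, and division
    with remainder finishes. *)
Lemma generators_mod_kernel U (v : nat -> F -> \bar int) k :
  mul_group U -> (forall i, (i < k)%N -> discrete_valuation (v i)) ->
  exists r (g : nat -> F), (forall i, (i < r)%N -> U (g i)) /\
    forall u, U u -> exists (a : nat -> int) w, [/\ U w,
      forall i, (i < k)%N -> ival (v i) w = 0 & u = w * \prod_(i < r) g i ^ a i].
Proof.
move=> UG; have [U1 Un0 UM UV] := UG.
elim: k => [|k IH] dv.
  exists 0%N, (fun=> 1); split=> // u Uu; exists (fun=> 0), u.
  by rewrite big_ord0 mulr1.
have [|r [g [Ug gU]]] := IH; first by move=> i /ltnW; apply: dv.
have dk := dv k (ltnSn k).
pose U1' := [set w | U w /\ forall i, (i < k)%N -> ival (v i) w = 0].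
have [[h [[Uh hv] hk]]|none] :=
    pselect (exists h, U1' h /\ ival (v k) h != 0); last first.
  exists r, g; split=> // u /gU[a [w [Uw wv uE]]]; exists a, w; split=> // i.
  rewrite ltnS leq_eqVlt => /orP[/eqP->|]; last exact: wv.
  by apply: contrapT => /eqP wk; apply: none; exists w.
pose Q n := `[< (0 < n)%N /\ exists h, U1' h /\ ival (v k) h = n%:Z >].
have exQ : exists n, Q n.
  exists `|ival (v k) h|%N; apply/asboolP; split; first by rewrite absz_gt0.
  have [h0|h0] := leP 0 (ival (v k) h); first by exists h; split=> //; lia.
  exists h^-1; rewrite ivalV //; last exact: Un0; split; last by lia.
  split=> [|i ik]; first exact: UV.
  by rewrite ivalV ?hv ?oppr0 //; [apply/dv/ltnW|apply: Un0].
case: (ex_minnP exQ) => n /asboolP[n0 [{hk}{Uh}{hv}h [[Uh hv] hn]]] nmin.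
exists r.+1, (fun i => if (i < r)%N then g i else h); split=> [i|u /gU[a [w [Uw wv uE]]]].
  by rewrite ltnS leq_eqVlt => /orP[/eqP->|ir]; rewrite ?ltnn // ir; apply: Ug.
pose q := (ival (v k) w %/ n%:Z)%Z; pose w' := w * h ^ (- q).
have hn0 := Un0 _ Uh; have wn0 := Un0 _ Uw.
have Uw' : U w' by apply: UM => //; apply: mul_group_expz.
have w'v i : (i < k)%N -> ival (v i) w' = 0.
  move=> ik; have di := dv i (ltnW ik).
  by rewrite ivalM ?expfz_neq0 // ivalXz // hv // wv // mul0r addr0.
have w'k : ival (v k) w' = (ival (v k) w %% n%:Z)%Z.
  by rewrite ivalM ?expfz_neq0 // ivalXz // hn /modz; lia.
exists (fun i => if (i < r)%N then a i else q), w'; split=> // [i|].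
  rewrite ltnS leq_eqVlt => /orP[/eqP->|]; last exact: w'v.
  apply: contrapT => /eqP wk.
  have ge0 : (0 <= ival (v k) w')%R by rewrite w'k modz_ge0 //; lia.
  have ltn : (ival (v k) w' < n%:Z)%R by rewrite w'k ltz_pmod //; lia.
  have /nmin : Q `|ival (v k) w'|%N.
    by apply/asboolP; split; [rewrite absz_gt0|exists w'; split=> //; lia].
  lia.
rewrite big_ord_recr /= ltnn uE.
under [in RHS]eq_bigr => i _ do rewrite ltn_ord.
by rewrite /w' -invr_expz; field; rewrite expfz_neq0.
Qed.

Definition S_unit (S : set (set F)) : set F :=
  [set u | [/\ u != 0, S_integral iota S u & S_integral iota S u^-1]].

Lemma S_unit_group S : mul_group (S_unit S).
Proof.
have [S1 _ SM] := @S_integral_subring K F iota S.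
have {}S1 : S_integral iota S 1 by apply/asboolP.
have {}SM x y : S_integral iota S x -> S_integral iota S y -> S_integral iota S (x * y).
  by move=> Sx Sy; apply/asboolP; apply: SM; apply/asboolP.
split.
- by split; rewrite ?invr1 ?oner_neq0.
- by move=> x [].
- move=> x y [xn0 Sx Sx'] [yn0 Sy Sy']; split; rewrite ?mulf_neq0 //; first exact: SM.
  by rewrite invfM; apply: SM.
by move=> x [xn0 Sx Sx']; split; rewrite ?invr_eq0 // invrK.
Qed.

(** A unit of value 0 at every place of S has no pole, so it is algebraic over K by [pole_exists];
    it need not lie in K. *)
Lemma S_unit_generators S : function_field iota -> finite_set S ->
  (forall P, S P -> is_place iota P) ->
  exists r (g : nat -> F), (forall i, (i < r)%N -> S_unit S (g i)) /\
    forall u, S_unit S u -> exists (a : nat -> int) c,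
      [/\ algebraicOver iota c, c != 0 & u = c * \prod_(i < r) g i ^ a i].
Proof.
move=> FK finS SP; have [k [v [Kv vS]]] := finite_places finS SP.
have dv i : (i < k)%N -> discrete_valuation (v i) by move=> /Kv[].
have [r [g [Ug gU]]] := generators_mod_kernel (S_unit_group S) dv.
exists r, g; split=> // u /gU[a [w [[wn0 Sw Sw'] wv uE]]].
exists a, w; split=> //; apply: contrapT => w_tr.
have [p [Kp]] := pole_exists FK w_tr; apply; have [dp _] := Kp.
have [Sp|Sp] := pselect (S (center p)); last by move/S_integralP: Sw; apply.
have [i ik pi] := (vS _).1 Sp; apply: (vge_center (dv i ik) dp) => //.
by rewrite /vge (ivalE (dv i ik) wn0) wv.
Qed.

End UnitGroup.

(** * Positive characteristic *)

(** Combine the relations with the coefficients of the product of the linear factors at all X_j with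
    j != i: only the i-th term survives. *)
Lemma vandermonde_kernel (R : idomainType) n (X z : 'I_n -> R) :
  injective X -> (forall m, (m < n)%N -> \sum_i z i * X i ^+ m = 0) -> forall i, z i = 0.
Proof.
move=> injX zX i; pose P := \prod_(j | j != i) ('X - (X j)%:P).
have : \sum_j z j * P.[X j] = 0.
  have szP : (size P <= n)%N.
    rewrite /P -big_filter size_prod_XsubC size_filter -sum1_count sum1_card.
    by rewrite cardC1 card_ord prednK // (leq_ltn_trans _ (ltn_ord i)).
  under eq_bigr => j _ do rewrite (horner_coef_wide _ szP) mulr_sumr.
  rewrite exchange_big big1 // => m _.
  under eq_bigr => j _ do rewrite mulrCA.
  by rewrite -mulr_sumr zX // mulr0.
rewrite (bigD1 i) //= big1 => [|j ji]; last first.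
  by rewrite horner_prod (bigD1 j) //= hornerXsubC subrr mul0r mulr0.
move=> /eqP; rewrite addr0 mulf_eq0 => /orP[/eqP//|].
rewrite horner_prod prodf_seq_eq0 => /hasP[j _ /andP[ji]].
by rewrite hornerXsubC subr_eq0 => /eqP/injX e; rewrite e eqxx in ji.
Qed.

Lemma large_fiber (T : finType) (f : nat -> T) n :
  exists2 l : 'I_n -> nat, injective l & forall i j, f (l i) = f (l j).
Proof.
pose M := (n * #|T|).+1; pose A t := [set i : 'I_M | f i == t]%SET.
have [t tA] : exists t, (n <= #|A t|)%N.
  apply: contrapT => nA; have lt t : (#|A t| <= n)%N.
    by rewrite leqNgt; apply/negP => h; apply: nA; exists t; apply: ltnW.
  have ME : M = (\sum_t #|A t|)%N.
    rewrite -[LHS]card_ord -sum1_card (partition_big (fun i : 'I_M => f i) xpredT) //=.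
    by apply: eq_bigr => t _; rewrite sum1dep_card.
  have : (\sum_t #|A t| <= \sum_(t : T) n)%N by apply: leq_sum.
  by rewrite -ME sum_nat_const mulnC ltnn.
have lA i : f (enum_val (widen_ord tA i)) = t.
  by have := enum_valP (widen_ord tA i); rewrite inE => /eqP.
exists (fun i => enum_val (widen_ord tA i) : nat) => [i j|i j]; last by rewrite !lA.
by move=> /val_inj/enum_val_inj e; apply: val_inj; have := congr1 val e.
Qed.

Lemma sum_ord_mul (V : nmodType) p q (f : nat -> V) :
  \sum_(i < p * q) f i = \sum_(a < p) \sum_(b < q) f (a + p * b)%N.
Proof.
elim: q => [|q IH].
  by rewrite muln0 big_ord0 big1 // => a _; rewrite big_ord0.
rewrite mulnS addnC big_split_ord /= IH -big_split /=.
by apply: eq_bigr => a _; rewrite big_ord_recr /= addnC.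
Qed.

Lemma XsubC_pchar (F : fieldType) p (x : F) : p \in [pchar F] ->
  ('X - x%:P) ^+ p = 'X^p - (x ^+ p)%:P.
Proof.
move=> charF; have charP : p \in [pchar {poly F}] by rewrite pchar_poly.
by rewrite -(pFrobenius_autE charP) rmorphB /= !pFrobenius_autE polyC_exp.
Qed.

Section PositiveCharacteristic.
Context (F : fieldType) (p : nat) (charF : p \in [pchar F]).

Lemma frobenius_sum e (I : finType) (P : pred I) (f : I -> F) :
  (\sum_(i | P i) f i) ^+ (p ^ e) = \sum_(i | P i) f i ^+ (p ^ e).
Proof.
elim: e => [|e IH]; first by rewrite expn0 expr1.
rewrite expnSr exprM IH -(pFrobenius_autE charF) rmorph_sum.
by apply: eq_bigr => i _; rewrite [LHS]pFrobenius_autE -exprM.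
Qed.

(** Frobenius on coefficients turns the gcd of sum_i w_i X^i and X^p - x into a scalar multiple of
    (X - x)^k, with 0 < k < p. Its two top coefficients exhibit - k x as a quotient of p-th powers,
    so x would be a p-th power. *)
Lemma not_pth_power_free1 x (w : 'I_p -> F) : (forall y, y ^+ p != x) ->
  \sum_i w i ^+ p * x ^+ i = 0 -> forall i, w i = 0.
Proof.
move=> nx wx i; have p_pr := pcharf_prime charF.
pose phi : {rmorphism F -> F} := pFrobenius_aut charF.
have phiE y : phi y = y ^+ p by apply: pFrobenius_autE.
pose g := \poly_(i < p) (if insub i is Some j then w j else 0).
have gi (j : 'I_p) : g`_j = w j by rewrite coef_poly ltn_ord valK.
suff g0 : g = 0 by rewrite -gi g0 coef0.
apply/eqP/negPn/negP => gn0.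
pose h := 'X^p - x%:P.
have hE : map_poly phi h = ('X - x%:P) ^+ p.
  by rewrite rmorphB /= map_polyXn map_polyC /= (XsubC_pchar x charF) pFrobenius_autE.
have xg : root (map_poly phi g) x.
  rewrite /root (@horner_coef_wide _ p) ?size_map_poly ?size_poly // -[X in _ == X]wx.
  by apply/eqP/eq_bigr => j _; rewrite coef_map gi /= phiE.
have [k kp] : exists2 k, (k <= p)%N & map_poly phi (gcdp g h) %= ('X - x%:P) ^+ k.
  by apply/dvdp_exp_XsubCP; rewrite -hE gcdp_map dvdp_gcdr.
have : root (map_poly phi (gcdp g h)) x.
  rewrite gcdp_map root_gcd xg hE /root horner_exp hornerXsubC subrr expr0n.
  by rewrite (gtn_eqF (prime_gt0 p_pr)) eqxx.
have : (size (gcdp g h) <= p)%N.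
  by apply: (@leq_trans (size g)); [apply: dvdp_leq (dvdp_gcdl _ _)|exact: size_poly].
move: (gcdp g h) => d szd rd dE; have szdE : size d = k.+1.
  by rewrite -(size_map_poly phi) (eqp_size dE) size_exp_XsubC.
have k0 : (0 < k)%N.
  rewrite lt0n; apply/eqP => k0; move: rd; rewrite (eqp_root dE) k0 expr0.
  by rewrite /root hornerC oner_eq0.
have dn0 : d != 0 by rewrite -size_poly_eq0 szdE.
have kn0 : k%:R != 0 :> F.
  by rewrite -(dvdn_pcharf charF) gtnNdvd // -ltnS -szdE ltnS.
have := eqp_eq dE; rewrite (monicP (monic_exp _ (monicXsubC x))) scale1r.
move: (lead_coef _) => c dc.
have ck : phi d`_k = c.
  have -> : phi d`_k = (map_poly phi d)`_k by rewrite coef_map.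
  have := monic_exp k (monicXsubC x); rewrite monicE lead_coefE size_exp_XsubC /= => /eqP lk.
  by rewrite dc coefZ lk mulr1.
have ck1 : phi d`_k.-1 = - (c * x *+ k).
  have -> : phi d`_k.-1 = (map_poly phi d)`_k.-1 by rewrite coef_map.
  rewrite dc coefZ.
  have -> : ('X - x%:P) ^+ k = \prod_(y <- nseq k x) ('X - y%:P).
    by rewrite big_nseq iter_mulr_1.
  have := @coefPn_prod_XsubC _ (nseq k x); rewrite size_nseq -lt0n => ->//.
  by rewrite big_nseq iter_addr_0 mulrN mulrnAr.
have cn0 : c != 0 by rewrite -ck fmorph_eq0 -[k]/(k.+1.-1) -szdE -lead_coefE lead_coef_eq0.
have /eqP[] := nx (- (d`_k.-1 / d`_k / k%:R)).
rewrite -phiE rmorphN !fmorph_div ck ck1 rmorph_nat /=.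
rewrite -mulr_natr; field; by rewrite kn0 cn0.
Qed.

(** Splitting i = a + p b writes the sum as one over a < p of p-th powers times x^a, where
    [not_pth_power_free1] applies; induction treats the inner sums over b. *)
Lemma not_pth_power_free x e (z : nat -> F) : (forall y, y ^+ p != x) ->
  \sum_(i < p ^ e) z i ^+ (p ^ e) * x ^+ i = 0 -> forall i, (i < p ^ e)%N -> z i = 0.
Proof.
move=> nx; elim: e z => [|e IH] z.
  rewrite expn0 big_ord1 expr1 expr0 mulr1 => z0 i; rewrite ltnS leqn0 => /eqP->//.
have p0 : (0 < p)%N by rewrite prime_gt0 // (pcharf_prime charF).
rewrite expnS (sum_ord_mul p (p ^ e) (fun i => z i ^+ (p * p ^ e) * x ^+ i)) => zx i ip.
pose w (a : 'I_p) := \sum_(b < p ^ e) z (a + p * b)%N ^+ (p ^ e) * x ^+ b.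
have w0 : forall a, w a = 0.
  apply: not_pth_power_free1 nx _; rewrite -[RHS]zx; apply: eq_bigr => a _.
  rewrite -[w a ^+ p](pFrobenius_autE charF) rmorph_sum mulr_suml; apply: eq_bigr => b _.
  rewrite [X in X * _]pFrobenius_autE exprMn -!exprM -mulrA -exprD.
  by rewrite [(b * p)%N]mulnC [(p ^ e * p)%N]mulnC [(_ + a)%N]addnC.
have im : (i %% p < p)%N by rewrite ltn_mod.
have := IH (fun b => z (i %% p + p * b)%N) (w0 (Ordinal im)) (i %/ p)%N.
by rewrite [(p * _)%N]mulnC addnC -divn_eq; apply; rewrite ltn_divLR // mulnC.
Qed.

End PositiveCharacteristic.

(** An irreducible factor f of X^p - a is separable, yet over a field containing a root z of f it
    divides (X - z)^p. So f is linear and its root lies in K. *)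
Lemma perfect_pth_root (K : fieldType) p (a : K) : perfect_field K -> p \in [pchar K] ->
  exists b, b ^+ p = a.
Proof.
move=> perfK charK; have p_pr := pcharf_prime charK.
pose q := 'X^p - a%:P; have szq : size q = p.+1 by rewrite size_XnsubC ?prime_gt0.
have qn0 : q != 0 by rewrite -size_poly_eq0 szq.
pose Q n := `[< exists f : {poly K}, [/\ (1 < size f)%N, f %| q & size f = n] >].
have exQ : exists n, Q n.
  by exists p.+1; apply/asboolP; exists q; rewrite szq ltnS prime_gt0.
case: (ex_minnP exQ) => _ /asboolP[f [szf fq <-]] fmin.
have fn0 : f != 0 by rewrite -size_poly_gt0 ltnW.
have irr_f : irreducible_poly f.
  split=> // g szg gf; have gn0 : g != 0 by apply: dvdpN0 fn0.
  rewrite -dvdp_size_eqp // eqn_leq dvdp_leq //=; apply: fmin; apply/asboolP.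
  exists g; split=> //; last exact: dvdp_trans fq.
  by rewrite ltn_neqAle eq_sym szg size_poly_gt0.
have [L _ [z fz _]] := irredp_FAdjoin irr_f.
pose phi : {rmorphism K -> L} := in_alg L.
have charL : p \in [pchar L] by rewrite (fmorph_pchar phi).
have sep : separable_poly (map_poly phi f) by rewrite separable_map; apply: perfK.
have zp : z ^+ p = phi a.
  have : root (map_poly phi q) z by apply: root_dvdp fz; rewrite dvdp_map.
  rewrite rmorphB /= map_polyXn map_polyC /root hornerD hornerN hornerXn hornerC subr_eq0.
  by move/eqP.
have : map_poly phi f %| ('X - z%:P) ^+ p.
  rewrite (XsubC_pchar z charL) zp.
  by rewrite -map_polyC -(map_polyXn phi) -rmorphB dvdp_map.
case/dvdp_exp_XsubCP=> k _ fk.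
have : (k <= 1)%N.
  rewrite leqNgt; apply/negP => k1.
  have := separable_nosquare (u := 'X - z%:P) sep k1; rewrite size_XsubC => /(_ isT).
  by rewrite (eqp_dvdr _ fk) dvdpp.
have := eqp_size fk; rewrite size_map_poly size_exp_XsubC => szfk k1.
have sz2 : size f = 2%N by apply/eqP; rewrite eqn_leq szf szfk ltnS k1.
have [b fb] : exists b, root f b.
  exists (- (f`_0 / f`_1)); rewrite /root horner_coef sz2 big_ord_recr big_ord1 /=.
  rewrite expr0 mulr1 expr1 mulrN mulrCA mulfV ?mulr1 ?subrr //.
  by rewrite -[1%N]/(2.-1) -sz2 -lead_coefE lead_coef_eq0.
exists b; have : root q b by apply: root_dvdp fb.
by rewrite /root hornerD hornerN hornerXn hornerC subr_eq0 => /eqP.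
Qed.

Section SIntegralFacts.
Context (K F : fieldType) (iota : {rmorphism K -> F}).
Context (FK : function_field iota) (S : set (set F)).

Lemma S_integral_is_subring : is_subring (S_integral iota S).
Proof.
have [S1 SB SM] := @S_integral_subring K F iota S; split.
- exact/asboolP.
- by move=> x y Sx Sy; apply/asboolP; apply: SB; apply/asboolP.
- by move=> x y Sx Sy; apply/asboolP; apply: SM; apply/asboolP.
Qed.

Lemma S_integral_root x n : (0 < n)%N -> S_integral iota S (x ^+ n) -> S_integral iota S x.
Proof.
move=> n0 /S_integralP Sx; apply/S_integralP => v Kv nS; have [dv _] := Kv.
apply: contrapT => xv; have := vgeV dv xv; rewrite subr0 => xv'.
apply: (not_vge1 dv); have xn0 : x != 0.
  by apply/eqP => x0; apply: xv; rewrite x0; apply: vge0.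
rewrite -(mulfV (expf_neq0 n xn0)); apply: vge_mul0 => //; first exact: Sx.
by rewrite -exprVn; have := vgeX dv n xv'; apply: vge_le; lia.
Qed.

Lemma nonconstant_S_integer : S !=set0 -> (forall P, S P -> is_place iota P) ->
  exists x v, [/\ S_integral iota S x, transcendental iota x, place_valuation iota v &
    ~ vge v 0 x].
Proof.
move=> [P SP] pS; have [v [Kv PE]] := place_center (pS P SP).
have [x [xu xv]] := pole_only_at FK Kv; exists x, v; split => //.
  apply/S_integralP => u Ku nS; apply: xu => // uv; apply: nS.
  by rewrite uv -PE.
move=> x_alg; have xn0 : x != 0.
  by apply/eqP => x0; apply: xv; rewrite x0; apply: vge0; case: Kv.
by have [] := vge_algebraic Kv x_alg xn0.
Qed.

End SIntegralFacts.

Section CharP.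
Context (K F : fieldType) (iota : {rmorphism K -> F}).
Context (p : nat) (charF : p \in [pchar F]) (perfK : perfect_field K).

Lemma perfect_root e (a : K) : exists b, b ^+ (p ^ e) = a.
Proof.
have charK : p \in [pchar K] by rewrite -(fmorph_pchar iota).
elim: e a => [|e IH] a; first by exists a; rewrite expn0 expr1.
have [b <-] := perfect_pth_root a perfK charK; have [c <-] := IH b.
by exists c; rewrite expnSr exprM.
Qed.

(* The powers c^(q^i) are linearly dependent over K; extracting roots of a relation
   expresses c as a combination of c^q, c^(q^2), ..., with q-th powers as
   coefficients. *)
Lemma algebraic_perfect_root e c : algebraicOver iota c -> exists d, d ^+ (p ^ e) = c.
Proof.
move=> /lin_span_powers[n /choice[A AE]]; set q := (p ^ e)%N.
have q0 : (0 < q)%N by rewrite expn_gt0 prime_gt0 // (pcharf_prime charF).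
have [|r [i1 ri1] rA] := @lin_dep _ 'I_n.+1 'I_n (fun i j => A (q ^ i)%N j).
  by rewrite !card_ord.
have rc : \sum_i iota (r i) * c ^+ (q ^ i) = 0.
  under eq_bigr => i _ do rewrite AE mulr_sumr.
  rewrite exchange_big big1 // => j _.
  transitivity (iota (\sum_i r i * A (q ^ i)%N j) * c ^+ j); last by rewrite rA rmorph0 mul0r.
  by rewrite rmorph_sum mulr_suml; apply: eq_bigr => k _; rewrite rmorphM mulrA.
pose i0 := [arg min_(i < i1 | r i != 0) (i : nat)].
have [ri0 i0min] : r i0 != 0 /\ forall i, r i != 0 -> (i0 <= i)%N.
  by rewrite /i0; case: arg_minnP => // k rk kmin.
have /choice[s sE] : forall i, exists s, s ^+ (q ^ i0) = r i => [i|].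
  by rewrite -expnM; apply: perfect_root.
have qe : (q ^ i0 = p ^ (e * i0))%N by rewrite -expnM.
have sn0 i : (s i == 0) = (r i == 0).
  by rewrite -sE expf_eq0 expn_gt0 q0.
have sc : \sum_(i : 'I_n.+1 | (i0 <= i)%N) iota (s i) * c ^+ (q ^ (i - i0)) = 0.
  have qi0 : (0 < q ^ i0)%N by rewrite expn_gt0 q0.
  suff : (\sum_(i : 'I_n.+1 | (i0 <= i)%N) iota (s i) * c ^+ (q ^ (i - i0))) ^+ (q ^ i0) == 0.
    by rewrite expf_eq0 qi0 => /eqP.
  rewrite qe frobenius_sum // -qe -[X in _ == X]rc; apply/eqP.
  rewrite [RHS](bigID (fun i : 'I_n.+1 => (i0 <= i)%N)) /= [X in _ + X]big1 ?addr0.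
    apply: eq_bigr => i i0i; rewrite exprMn -rmorphXn sE; congr (_ * _).
    by rewrite -exprM -expnD subnK.
  move=> i; rewrite -ltnNge => ii0; have [->|/i0min] := eqVneq (r i) 0.
    by rewrite rmorph0 mul0r.
  by rewrite leqNgt ii0.
have /choice[b bE] := fun i => perfect_root e (- (s i / s i0)).
exists (\sum_(i : 'I_n.+1 | (i0 <= i)%N && (i != i0)) iota (b i) * c ^+ (q ^ (i - i0).-1)).
have si0 : iota (s i0) != 0 by rewrite fmorph_eq0 sn0.
rewrite frobenius_sum //; apply: (mulfI si0); apply/eqP; rewrite -subr_eq0 -opprB oppr_eq0.
move: sc; rewrite (bigD1 i0) //= subnn expn0 expr1 => /eqP; rewrite addr_eq0 => /eqP ->.
rewrite mulr_sumr -sumrN -sumrB big1 // => i /andP[i0i ii0].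
have -> : (i - i0)%N = (i - i0).-1.+1.
  by rewrite prednK // subn_gt0 ltn_neqAle i0i eq_sym ii0.
rewrite exprMn -rmorphXn /= bE rmorphN fmorph_div /= expnSr exprM; by field.
Qed.

Lemma not_sum_of_S_units_charp (S : set (set F)) N :
  function_field iota -> finite_set S -> S !=set0 -> (forall P, S P -> is_place iota P) ->
  exists2 s, S_integral iota S s & forall k (e : 'I_k -> F), (k <= N)%N ->
    (forall i, S_unit iota S (e i)) -> s <> \sum_i e i.
Proof.
move=> FK finS Sne Sp.
have [x [Sx x_tr x_root]] : exists x, [/\ S_integral iota S x, transcendental iota x &
    forall y, y ^+ p != x].
  have [x0 [v [Sx0 x0_tr Kv x0v]]] := nonconstant_S_integer FK Sne Sp.
  have [dv _] := Kv; have p_pr := pcharf_prime charF; have p1 := prime_gt1 p_pr.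
  have x0n0 : x0 != 0 by apply/eqP => z; apply: x0v; rewrite z; apply: vge0.
  have iv0 : ival v x0 != 0.
    by apply/eqP => iv; apply: x0v; rewrite /vge (ivalE dv x0n0) iv.
  (* As x0 may be a p-th power, pass to a p^j-th root with j largest; j is bounded because p^j
     divides the nonzero value of x0 at its pole v. *)
  pose Q j := `[< exists y, y ^+ (p ^ j) = x0 >].
  have Q0 : exists j, Q j by exists 0%N; apply/asboolP; exists x0; rewrite expn0 expr1.
  have Qb j : Q j -> (j <= `|ival v x0|)%N.
    move=> /asboolP[y yE]; have yn0 : y != 0.
      by apply: contraNneq x0n0 => y0; rewrite -yE y0 expr0n gtn_eqF ?eqxx // expn_gt0 prime_gt0.
    apply: leq_trans (ltnW (ltn_expl j p1)) _; move: iv0; rewrite -yE ivalX //.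
    rewrite -mulr_natr natz abszM mulf_eq0 negb_or -absz_gt0 => /andP[iy _].
    by rewrite leq_pmull.
  have [j /asboolP[x xE] jmax] := ex_maxnP Q0 Qb; exists x; split.
  - by apply: (@S_integral_root _ _ _ _ _ (p ^ j)); rewrite ?expn_gt0 ?prime_gt0 // xE.
  - move=> x_alg; apply: x0_tr; rewrite -xE; elim: (p ^ j)%N => [|m IH].
      by rewrite expr0; apply: algebraic1.
    by rewrite exprS; apply: algebraic_mul.
  move=> y; apply/eqP => yx; have : Q j.+1.
    by apply/asboolP; exists y; rewrite expnS exprM yx.
  by move/jmax; rewrite ltnn.
have [r [g [Ug gU]]] := S_unit_generators FK finS Sp.
have p1 := prime_gt1 (pcharf_prime charF).
pose q := (p ^ N)%N; have Nq : (N < q)%N by apply: ltn_expl.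
have q0 : (0 < q)%N by apply: leq_ltn_trans Nq.
pose s l := \sum_(m < q) x ^+ (m * (l * q + 1)).
apply: contrapT => nS.
have Ss l : S_integral iota S (s l).
  apply: (subring_sum (S_integral_is_subring iota S)) => m _.
  exact: (subringX (S_integral_is_subring iota S)).
pose G (b : {ffun 'I_r -> 'I_q}) := \prod_(i < r) g i ^+ b i.
have unitE u : S_unit iota S u -> exists wb : F * {ffun 'I_r -> 'I_q}, u = wb.1 ^+ q * G wb.2.
  (* The remainders of the exponents modulo q form the monomial; their quotients and a q-th root of
     the constant go into the q-th power. *)
  move=> /gU[a [c [c_alg cn0 ->]]]; have [d dE] := algebraic_perfect_root N c_alg.
  have modq i : (`|(a i %% q%:Z)%Z| < q)%N.
    have := ltz_pmod (a i) (_ : 0 < q%:Z)%R; have := modz_ge0 (a i) (_ : q%:Z != 0)%R; lia.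
  exists (d * \prod_(i < r) g i ^ (a i %/ q%:Z)%Z, [ffun i : 'I_r => Ordinal (modq i)]) => /=.
  rewrite exprMn dE -mulrA; congr (_ * _).
  rewrite -prodrXl -big_split /=; apply: eq_bigr => i _; rewrite ffunE /=.
  have gn0 : g i != 0 by have [] := Ug i (ltn_ord i).
  rewrite !exprnP exprz_exp -expfzDr //; congr (_ ^ _).
  have := divz_eq (a i) q%:Z; have := modz_ge0 (a i) (_ : q%:Z != 0)%R; lia.
have sE l : exists wb : {ffun 'I_N -> F * {ffun 'I_r -> 'I_q}},
    s l = \sum_j (wb j).1 ^+ q * G (wb j).2.
  have [k [e [kN [eU se]]]] : exists k (e : 'I_k -> F),
      (k <= N)%N /\ (forall i, S_unit iota S (e i)) /\ s l = \sum_i e i.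
    apply: contrapT => nk; apply: nS; exists (s l) => // k e kN eU se.
    by apply: nk; exists k, e.
  have /choice[wb wbE] := fun i => unitE _ (eU i).
  (* Zeros pad the sum to exactly N terms, so that its monomials form a point of one finite type. *)
  pose u j := if insub j is Some i then e i else 0.
  have ue (i : 'I_k) : u i = e i by rewrite /u valK.
  have /choice[wb' wbE'] : forall j : nat, exists wb : F * {ffun 'I_r -> 'I_q},
      u j = wb.1 ^+ q * G wb.2.
    move=> j; rewrite /u; case: insubP => [i _ _|_]; first by exists (wb i).
    by exists (0, [ffun=> Ordinal q0]); rewrite expr0n gtn_eqF // mul0r.
  exists [ffun j : 'I_N => wb' j]; rewrite se.
  under eq_bigr => i _ do rewrite -ue.
  rewrite (big_ord_widen N u) // big_mkcond /=; apply: eq_bigr => j _.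
  rewrite ffunE -wbE'; case: ifP => // jk.
  by rewrite /u insubN ?jk.
have /choice[wb wbE] := sE.
have [l l_inj lE] := large_fiber (fun i => [ffun j => (wb i j).2]) q.
(* Here q > N vectors of length N are dependent over F; Frobenius makes this a relation among the s
   (l i) with coefficients z_i^q. *)
have [|z [i zi] zw] := @lin_dep _ _ _ (fun (i : 'I_q) (j : 'I_N) => (wb (l i) j).1).
  by rewrite !card_ord.
have zs : \sum_i z i ^+ q * s (l i) = 0.
  have GE j : exists c, forall i, G (wb (l i) j).2 = c.
    exists (G (wb (l i) j).2) => i'; congr G.
    by have /ffunP/(_ j) := lE i' i; rewrite !ffunE.
  have /choice[c cE] := GE.
  under eq_bigr => i' _.
    rewrite wbE mulr_sumr; under eq_bigr => j _ do rewrite cE mulrA -exprMn.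
    over.
  rewrite exchange_big big1 //= => j _; rewrite -mulr_suml.
  by rewrite -frobenius_sum // zw expr0n gtn_eqF // mul0r.
have x_inj a b : x ^+ a = x ^+ b -> a = b.
  move=> ab; apply: contrapT => /eqP ne; apply: x_tr; exists ('X^a - 'X^b).
    apply: contraNneq ne => /polyP/(_ a)/eqP; rewrite coefB !coefXn eqxx coef0.
    by case: (a == b) => //; rewrite subr0 oner_eq0.
  by apply/eqP; rewrite -evE rmorphB /= !evXn ab subrr.
(* Sorted by powers of x, the relation has the q-th power of this sum as its coefficient of x^m. *)
have zx m : (m < q)%N -> \sum_i z i * (x ^+ l i) ^+ m = 0.
  apply: (not_pth_power_free charF (z := fun m => \sum_i z i * (x ^+ l i) ^+ m) x_root).
  rewrite -[RHS]zs -/q; under eq_bigr => j _ do rewrite frobenius_sum // mulr_suml.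
  rewrite exchange_big; apply: eq_bigr => i' _; rewrite mulr_sumr.
  apply: eq_bigr => j _; rewrite exprMn -mulrA -/q -!exprM -exprD; congr (_ * _ ^+ _).
  by rewrite mulnDr muln1 mulnA [(j * _)%N]mulnC.
have X_inj : injective (fun i => x ^+ l i) by move=> a b /x_inj/l_inj.
by rewrite (vandermonde_kernel X_inj zx) eqxx in zi.
Qed.

End CharP.

(** * Characteristic zero *)

Section Derivation.
Context (K F : fieldType) (iota : {rmorphism K -> F}).
Context (char0 : forall n, n.+1%:R != 0 :> F).

(* A derivation defined on a subring of F is encoded by its graph, which is a
   subring of the dual numbers F[eps] = F * F. *)
Definition derivation_graph (G : set (F * F)) := [/\ G (1, 0),
  forall u w, G u -> G w -> G (u.1 - w.1, u.2 - w.2),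
  forall u w, G u -> G w -> G (u.1 * w.1, u.1 * w.2 + u.2 * w.1) &
  forall b, G (0, b) -> b = 0].

Section Extension.
Context (G : set (F * F)) (derG : derivation_graph G).

Let E : set F := [set a | exists b, G (a, b)].

Let D (a : F) : F := xget 0 [set b | G (a, b)].

Let GD a : E a -> G (a, D a).
Proof. by case=> b Gab; rewrite /D; case: xgetP => [_ -> //|/(_ b)]. Qed.

Let G_fun a b : G (a, b) -> D a = b.
Proof.
move=> Gab; have [_ GB _ G0] := derG; apply/eqP; rewrite -subr_eq0; apply/eqP/G0.
have /GD Ga : E a by exists b.
by have := GB _ _ Ga Gab; rewrite /= subrr.
Qed.

Let ringE : is_subring E.
Proof.
have [G1 GB GM _] := derG; split; first by exists 0.
- by move=> a c /GD Ga /GD Gc; exists (D a - D c); apply: (GB _ _ Ga Gc).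
by move=> a c /GD Ga /GD Gc; exists (a * D c + D a * c); apply: (GM _ _ Ga Gc).
Qed.

Let DB a c : E a -> E c -> D (a - c) = D a - D c.
Proof. by move=> /GD Ga /GD Gc; apply: G_fun; have [_ GB _ _] := derG; apply: (GB _ _ Ga Gc). Qed.

Let DM a c : E a -> E c -> D (a * c) = a * D c + D a * c.
Proof. by move=> /GD Ga /GD Gc; apply: G_fun; have [_ _ GM _] := derG; apply: (GM _ _ Ga Gc). Qed.

Let D0 : D 0 = 0.
Proof. by rewrite -(subrr 1) DB ?subrr //; case: ringE. Qed.

Let DD a c : E a -> E c -> D (a + c) = D a + D c.
Proof.
move=> Ea Ec; rewrite -{1}[c]opprK DB //; last exact: subringN.
by rewrite -[- c]sub0r DB ?D0 ?sub0r ?opprK //; apply: subring0.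
Qed.

Let D_sum (I : finType) (f : I -> F) : (forall i, E (f i)) -> D (\sum_i f i) = \sum_i D (f i).
Proof.
move=> Ef; suff [] : E (\sum_i f i) /\ D (\sum_i f i) = \sum_i D (f i) by [].
elim/big_rec2: _ => [|i a b _ [Eb <-]]; first by split; [exact: subring0|exact: D0].
by split; [apply: subringD|rewrite DD].
Qed.

Let overE (f : {poly F}) := forall i, E f`_i.

Let mapD (f : {poly F}) : {poly F} := map_poly D f.

Let coef_mapD f i : (mapD f)`_i = D f`_i.
Proof. by rewrite coef_map_id0 // D0. Qed.

Let mapDB f g : overE f -> overE g -> mapD (f - g) = mapD f - mapD g.
Proof. by move=> Ef Eg; apply/polyP => i; rewrite coefB !coef_mapD coefB DB. Qed.

Let mapDM f g : overE f -> overE g -> mapD (f * g) = f * mapD g + mapD f * g.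
Proof.
move=> Ef Eg; apply/polyP => i; rewrite coefD coef_mapD !coefM -big_split /= D_sum.
  by apply: eq_bigr => j _; rewrite DM // !coef_mapD.
by move=> j; have [_ _ EM] := ringE; apply: EM.
Qed.

Let overE_mul f g : overE f -> overE g -> overE (f * g).
Proof.
move=> Ef Eg i; rewrite coefM; apply: subring_sum => // j _.
by have [_ _ EM] := ringE; apply: EM.
Qed.

Let overE_sub f g : overE f -> overE g -> overE (f - g).
Proof. by move=> Ef Eg i; rewrite coefB; have [_ EB _] := ringE; apply: EB. Qed.

Let overE_C c : E c -> overE c%:P.
Proof. by move=> Ec i; rewrite coefC; case: eqP => // _; apply: subring0. Qed.

Let overE_Xn n : overE 'X^n.
Proof.
move=> i; rewrite coefXn; case: eqP => _; last exact: subring0.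
by case: ringE.
Qed.

(** The derivation is extended to E[y]. Characteristic 0 gives m'(y) != 0 for an annihilator m of
    least degree. The extension is well defined because [delta] vanishes on every polynomial over E
    with root y. *)
Lemma derivation_graph_extend y (f : {poly F}) : f != 0 -> overE f -> root f y ->
  exists G', [/\ derivation_graph G', G `<=` G' & exists b, G' (y, b)].
Proof.
move=> fn0 Ef fy.
pose Q n := `[< exists m, [/\ m != 0, overE m, root m y & size m = n] >].
have exQ : exists n, Q n by exists (size f); apply/asboolP; exists f.
case: (ex_minnP exQ) => _ /asboolP[m [mn0 Em my <-]] mmin.
have small g : overE g -> root g y -> (size g < size m)%N -> g = 0.
  move=> Eg gy gm; apply: contraTeq gm => gn0; rewrite -leqNgt; apply: mmin.
  by apply/asboolP; exists g.
have szm : (1 < size m)%N by apply: root_size_gt1 my.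
have m'y : m^`().[y] != 0.
  apply/negP => m'y0; have : m^`() = 0.
    apply: small => //; last by rewrite lt_size_deriv.
    move=> i; rewrite coef_deriv -mulr_natr; have [_ _ EM] := ringE; apply: EM => //.
    elim: (i.+1) => [|n IH]; first exact: subring0.
    by rewrite mulrSr; apply: subringD => //; case: ringE.
  move/polyP/(_ (size m).-2); rewrite coef_deriv coef0 -mulr_natr => /eqP.
  have szE : (size m).-2.+1 = (size m).-1 by case: (size m) szm => [|[]].
  rewrite szE -lead_coefE mulf_eq0 lead_coef_eq0 (negPf mn0) /=.
  by rewrite -szE (negPf (char0 _)).
pose dy := - (mapD m).[y] / m^`().[y].
(* delta g is the value at g.[y] of the extension of the derivation sending y to
   dy; the choice of dy makes it vanish on the minimal polynomial m. *)
pose delta (g : {poly F}) := (mapD g).[y] + g^`().[y] * dy.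
have deltaB g h : overE g -> overE h -> delta (g - h) = delta g - delta h.
  by move=> Eg Eh; rewrite /delta mapDB // derivB !hornerD !hornerN; ring.
have deltaM g h : overE g -> overE h -> delta (g * h) = g.[y] * delta h + delta g * h.[y].
  by move=> Eg Eh; rewrite /delta mapDM // derivM !hornerD !hornerM; ring.
have deltaC c : delta c%:P = D c.
  rewrite /delta derivC horner0 mul0r addr0.
  rewrite [mapD _](_ : _ = (D c)%:P) ?hornerC //; apply/polyP => i.
  by rewrite coef_mapD !coefC; case: eqP => // _; rewrite D0.
have delta_m : delta m = 0 by rewrite /delta /dy mulrC divfK // addrN.
have delta0 g : overE g -> root g y -> delta g = 0.
  move: {2}(size g) (leqnn (size g)) => n; elim: n g => [|n IH] g szg Eg gy.
    by move: szg; rewrite leqn0 size_poly_eq0 => /eqP->; rewrite -polyC0 deltaC D0.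
  have [gm|mg] := ltnP (size g) (size m).
    by rewrite (small g) // -polyC0 deltaC D0.
  (* Pseudo-division: E is only a ring, so g is multiplied by the leading coefficient of m before a
     multiple of m is subtracted. *)
  pose c := lead_coef m; pose k := (size g - size m)%N.
  have Ec : E c by rewrite /c lead_coefE.
  pose h := (lead_coef g)%:P * 'X^k.
  have Eh : overE h by apply: overE_mul => //; apply: overE_C; rewrite lead_coefE.
  have Ecg : overE (c%:P * g) by apply: overE_mul => //; apply: overE_C.
  have Ehm : overE (h * m) by apply: overE_mul.
  have cn0 : c != 0 by rewrite lead_coef_eq0.
  have gn0 : g != 0 by rewrite -size_poly_gt0 (leq_trans _ mg) // ltnW.
  have : delta (c%:P * g - h * m) = 0.
    apply: IH; [|exact: overE_sub|]; last first.
      by rewrite /root hornerD hornerN !hornerM (eqP gy) (eqP my) !mulr0 subrr.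
    apply/leq_sizeP => j nj; rewrite coefB /h -mulrA !coefCM coefXnM ltnNge.
    have -> : (k <= j)%N by rewrite (leq_trans _ nj) // /k; lia.
    have [jg|gj] := ltnP j (size g).
      have jE : j = (size g).-1 by lia.
      have -> : (j - k = (size m).-1)%N by rewrite jE /k; lia.
      by rewrite jE -!lead_coefE [c * _]mulrC subrr.
    have -> : g`_j = 0 by rewrite nth_default.
    have -> : m`_(j - k) = 0
      by rewrite nth_default // /k; move: gj mg; move: (size g) (size m) => sg sm; lia.
    by rewrite !mulr0 subrr.
  rewrite deltaB // (deltaM _ _ (overE_C Ec) Eg) (deltaM _ _ Eh Em).
  rewrite delta_m (eqP my) (eqP gy) hornerC !mulr0 !addr0 subr0.
  by move=> /eqP; rewrite mulf_eq0 (negPf cn0) => /eqP.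
exists [set u | exists g, overE g /\ u = (g.[y], delta g)]; split.
- split.
  + exists 1; split; last by rewrite -polyC1 hornerC deltaC (@G_fun 1 0) //; case: derG.
    by rewrite -polyC1; apply: overE_C; case: ringE.
  + move=> _ _ [g [Eg ->]] [h [Eh ->]]; exists (g - h); split; first exact: overE_sub.
    by rewrite deltaB // hornerD hornerN.
  + move=> _ _ [g [Eg ->]] [h [Eh ->]]; exists (g * h); split; first exact: overE_mul.
    by rewrite deltaM // hornerM.
  + by move=> b [g [Eg [gy ->]]]; apply: delta0 => //; apply/eqP.
- move=> [a b] Gab; exists a%:P; split; first by apply: overE_C; exists b.
  by rewrite hornerC deltaC (G_fun Gab).
exists dy, 'X; split; first exact: (overE_Xn 1).
rewrite hornerX /delta derivX hornerC mul1r; congr pair.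
rewrite [mapD _](_ : _ = 0) ?horner0 ?add0r //; apply/polyP => i.
rewrite coef_mapD coefX coef0; case: eqP => _; last exact: D0.
by rewrite (@G_fun 1 0) //; case: derG.
Qed.

End Extension.

Definition is_derivation (D : F -> F) :=
  [/\ forall a b, D (a - b) = D a - D b, forall a b, D (a * b) = a * D b + D a * b &
      forall c, D (iota c) = 0].

(** Zorn's lemma extends x d/dx on K[x] to a maximal derivation, which is total because every y is
    algebraic over K(x). The choice D x = x makes the powers of x eigenvectors of D. *)
Lemma derivation_exists x : function_field iota -> transcendental iota x ->
  exists D, is_derivation D /\ D x = x.
Proof.
move=> FK x_tr; have [n rk] := rank_finite FK x_tr.
pose B : set (F * F) := [set u | exists p, u = (ev iota x p, x * ev iota x p^`())].
pose P (G : set (F * F)) := G = set0 \/ (derivation_graph G /\ B `<=` G).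
have BP : P B.
  right; split=> //; split.
  - by exists 1; rewrite rmorph1 -polyC1 derivC rmorph0 mulr0.
  - move=> _ _ [p ->] [q ->]; exists (p - q).
    by rewrite derivB !rmorphB mulrBr.
  - move=> _ _ [p ->] [q ->]; exists (p * q).
    by rewrite derivM rmorphD !rmorphM /=; congr pair; ring.
  by move=> b [p [/esym/eqP]]; rewrite ev_eq0 // => /eqP -> ->; rewrite deriv0 rmorph0 mulr0.
have [Fm FmP Ftot|G [PG maxG]] := @Zorn_bigcup _ P.
  have [[X0 [FX0 [x0 X0x0]]]|none] := pselect (exists X, Fm X /\ X !=set0); last first.
    left; apply/seteqP; split=> // u [X FX Xu]; apply: none.
    by exists X; split=> //; exists u.
  right; have Fne X u : Fm X -> X u -> derivation_graph X /\ B `<=` X.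
    by move=> /FmP[->|].
  have pair_in u w : (\bigcup_(X in Fm) X) u -> (\bigcup_(X in Fm) X) w ->
      exists X, [/\ Fm X, derivation_graph X, X u & X w].
    move=> [X FX Xu] [Y FY Yw]; have [XY|YX] := Ftot X Y FX FY.
      by exists Y; split=> //; [case: (Fne _ _ FY Yw)|apply: XY].
    by exists X; split=> //; [case: (Fne _ _ FX Xu)|apply: YX].
  have [[X01 _ _ _] BX0] := Fne _ _ FX0 X0x0.
  split; last by move=> u /BX0; exists X0.
  split; first by exists X0.
  - by move=> u w /pair_in h/h[X [FX [_ XB _ _] Xu Xw]]; exists X => //; apply: XB.
  - by move=> u w /pair_in h/h[X [FX [_ _ XM _] Xu Xw]]; exists X => //; apply: XM.
  by move=> b [X FX Xb]; have [[_ _ _ +] _] := Fne _ _ FX Xb; apply.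
have [derG BG] : derivation_graph G /\ B `<=` G.
  case: PG => [G0|//]; case: (maxG B) => //; rewrite G0; split=> // B0.
  by apply: (B0 (1, 0)); exists 1; rewrite rmorph1 -polyC1 derivC rmorph0 mulr0.
have total y : exists b, G (y, b).
  have [p [i0 pi0] py] := rk (fun i => y ^+ i).
  pose f := \poly_(i < n.+1) ev iota x (p (inord i)).
  have fE (i : 'I_n.+1) : f`_i = ev iota x (p i) by rewrite coef_poly ltn_ord inord_val.
  have fn0 : f != 0.
    by apply: contraNneq pi0 => f0; rewrite -(ev_eq0 _ x_tr) -fE f0 coef0.
  have fG i : exists b, G (f`_i, b).
    rewrite coef_poly; case: ifP => _; first by eexists; apply: BG; eexists.
    by exists 0; apply: BG; exists 0; rewrite deriv0 !rmorph0 mulr0.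
  have fy : root f y.
    by rewrite /root horner_poly -[X in _ == X]py; apply/eqP/eq_bigr => i _; rewrite inord_val.
  have [G' [derG' GG' [b G'b]]] := derivation_graph_extend derG fn0 fG fy.
  exists b; apply: contrapT => nG; apply: (maxG G').
    by split=> // G'G; apply: nG; apply: G'G.
  by right; split=> //; apply: subset_trans GG'.
have /choice[D DG] := total.
have D_fun a b : G (a, b) -> D a = b.
  move=> Gab; have [_ GB _ G0] := derG; apply/eqP; rewrite -subr_eq0; apply/eqP/G0.
  by have := GB _ _ (DG a) Gab; rewrite /= subrr.
have [_ GB GM _] := derG.
exists D; split; first split.
- by move=> a b; apply: D_fun; apply: (GB _ _ (DG a) (DG b)).
- by move=> a b; apply: D_fun; apply: (GM _ _ (DG a) (DG b)).
- by move=> c; apply: D_fun; apply: BG; exists c%:P; rewrite derivC evC rmorph0 mulr0.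
by apply: D_fun; apply: BG; exists 'X; rewrite derivX evX rmorph1 mulr1.
Qed.

End Derivation.

(** * Logarithmic derivatives and their iterates *)

Section DerivationTheory.
Context (K F : fieldType) (iota : {rmorphism K -> F}).
Context (char0 : forall n, n.+1%:R != 0 :> F).
Context (D : F -> F) (derD : is_derivation iota D).

Lemma derB a b : D (a - b) = D a - D b. Proof. by case: derD. Qed.

Lemma derM a b : D (a * b) = a * D b + D a * b. Proof. by case: derD. Qed.

Lemma der_const c : D (iota c) = 0. Proof. by case: derD. Qed.

Lemma der0 : D 0 = 0. Proof. by rewrite -[X in D X](rmorph0 iota) der_const. Qed.

Lemma der1 : D 1 = 0. Proof. by rewrite -(rmorph1 iota) der_const. Qed.

Lemma derD2 a b : D (a + b) = D a + D b.
Proof. by rewrite -{1}[b]opprK derB -[- b]sub0r derB der0 sub0r opprK. Qed.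

Lemma der_sum (I : finType) (f : I -> F) : D (\sum_i f i) = \sum_i D (f i).
Proof. exact: (big_morph D derD2 der0). Qed.

Lemma derZ c a : D (iota c * a) = iota c * D a.
Proof. by rewrite derM der_const mul0r addr0. Qed.

Lemma derX a n : D (a ^+ n.+1) = a ^+ n * D a *+ n.+1.
Proof.
elim: n => [|n IH]; first by rewrite expr0 expr1 mul1r mulr1n.
by rewrite exprS derM IH mulrnAr mulrA -exprS [D a * _]mulrC -mulrSr.
Qed.

(** For m of least degree with m(c) = 0, applying D gives m'(c) D c = 0, and m'(c) != 0 in
    characteristic 0. *)
Lemma der_algebraic c : algebraicOver iota c -> D c = 0.
Proof.
case=> f fn0 fc.
pose Q n := `[< exists m : {poly K}, [/\ m != 0, root (map_poly iota m) c & size m = n] >].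
have exQ : exists n, Q n by exists (size f); apply/asboolP; exists f.
case: (ex_minnP exQ) => _ /asboolP[m [mn0 mc <-]] mmin.
have szm : (1 < size m)%N.
  by rewrite -(size_map_poly iota); apply: root_size_gt1 mc; rewrite map_poly_eq0.
have m'c : (map_poly iota m)^`().[c] != 0.
  apply/negP => m'c0; have m'n0 : m^`() != 0.
    apply/eqP => /polyP/(_ (size m).-2); rewrite coef_deriv coef0 -mulr_natr => /eqP.
    have szE : (size m).-2.+1 = (size m).-1 by case: (size m) szm => [|[]].
    rewrite szE -lead_coefE mulf_eq0 lead_coef_eq0 (negPf mn0) /= -szE.
    by rewrite -(fmorph_eq0 iota) rmorph_nat (negPf (char0 _)).
  have : (size m <= size m^`())%N.
    by apply: mmin; apply/asboolP; exists m^`(); rewrite -deriv_map.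
  by rewrite leqNgt lt_size_deriv.
have eval_der (g : {poly K}) : D (map_poly iota g).[c] = (map_poly iota g)^`().[c] * D c.
  elim/poly_ind: g => [|g d IH]; first by rewrite rmorph0 deriv0 !horner0 der0 mul0r.
  rewrite rmorphD rmorphM /= map_polyX map_polyC hornerMXaddC derD2 derM IH der_const.
  by rewrite derivD derivM derivX derivC !hornerE; ring.
by have := eval_der m; rewrite (eqP mc) der0 => /esym/eqP; rewrite mulf_eq0 (negPf m'c) => /eqP.
Qed.

Lemma logder_prod r (g : nat -> F) (a : nat -> int) : (forall i, (i < r)%N -> g i != 0) ->
  D (\prod_(i < r) g i ^ a i) =
  \prod_(i < r) g i ^ a i * \sum_(i < r) (D (g i) / g i) *~ a i.
Proof.
move=> gn0.
have logX x n : x != 0 -> D (x ^+ n) = x ^+ n * ((D x / x) *+ n).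
  move=> xn0; case: n => [|n]; first by rewrite expr0 der1 mulr0n mulr0.
  by rewrite derX mulrnAr exprS; congr (_ *+ _); field.
have logV x : x != 0 -> D x^-1 = - (D x / x ^+ 2).
  move=> xn0; have := derM x x^-1; rewrite mulfV // der1 => /esym/eqP.
  rewrite addr_eq0 => /eqP e; apply: (mulfI xn0); rewrite e; field; exact: xn0.
have logXz x (n : int) : x != 0 -> D (x ^ n) = x ^ n * ((D x / x) *~ n).
  move=> xn0; case: n => n; first by rewrite -exprnP logX // pmulrn.
  rewrite NegzE -invr_expz -exprnP logV ?expf_neq0 // logX // mulrNz -pmulrn.
  by field; rewrite ?expf_neq0 ?xn0.
elim: r gn0 => [|r IH] gn0; first by rewrite !big_ord0 der1 mulr0.
rewrite !big_ord_recr /= derM IH ?logXz ?gn0 // => [|i ir]; last by rewrite gn0 // ltnW.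
by ring.
Qed.

(** The complete Bell polynomial in lam, D lam, D^2 lam, ...: it expresses D^m u / u through lam = D
    u / u. *)
Fixpoint iter_factor (lam : F) (m : nat) : F :=
  if m is m'.+1 then D (iter_factor lam m') + lam * iter_factor lam m' else 1.

Lemma iter_der_factor u lam m : D u = u * lam -> iter m D u = u * iter_factor lam m.
Proof.
move=> uE; elim: m => [|m IH] /=; first by rewrite mulr1.
by rewrite IH derM uE mulrDr mulrA.
Qed.

Lemma iter_der_sum m (I : finType) (f : I -> F) :
  iter m D (\sum_i f i) = \sum_i iter m D (f i).
Proof. by elim: m => [|m IH] //=; rewrite IH der_sum. Qed.

Lemma iter_der_power x m n : D x = x -> iter m D (x ^+ n) = n%:R ^+ m * x ^+ n.
Proof.
move=> Dx; elim: m => [|m IH] /=; first by rewrite expr0 mul1r.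
have der_nat k a : D (k%:R * a) = k%:R * D a by rewrite -(rmorph_nat iota k) derZ.
rewrite IH -{1}natrX der_nat natrX exprSr -mulrA; congr (_ * _).
case: n {IH} => [|n]; first by rewrite expr0 der1 mul0r.
by rewrite derX Dx -exprSr mulr_natl.
Qed.

Lemma lin_span_inl (I J : finType) (Y : I -> F) (Z : J -> F) z :
  lin_span iota Y z -> lin_span iota (fun s => match s with inl i => Y i | inr j => Z j end) z.
Proof.
case=> c ->; exists (fun s => match s with inl i => c i | inr j => 0 end).
rewrite big_sumType /= [X in _ + X]big1 ?addr0 // => j _.
by rewrite rmorph0 mul0r.
Qed.

Lemma lin_span_inr (I J : finType) (Y : I -> F) (Z : J -> F) z :
  lin_span iota Z z -> lin_span iota (fun s => match s with inl i => Y i | inr j => Z j end) z.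
Proof.
case=> c ->; exists (fun s => match s with inl i => 0 | inr j => c j end).
rewrite big_sumType /= [X in X + _]big1 ?add0r // => j _.
by rewrite rmorph0 mul0r.
Qed.

Lemma lin_spanD (I : finType) (Y : I -> F) y z :
  lin_span iota Y y -> lin_span iota Y z -> lin_span iota Y (y + z).
Proof.
case=> c -> [d ->]; exists (fun i => c i + d i).
by rewrite -big_split /=; apply: eq_bigr => i _; rewrite rmorphD mulrDl.
Qed.

(** The space for M + 1 is spanned by generators of the one for M, their derivatives and their
    products with the l_i. The exponents a enter only through coefficients in K, so one space serves
    all units. *)
Lemma iter_factor_span r (l : 'I_r -> F) M :
  exists (J : finType) (v : J -> F), forall m (a : 'I_r -> int), (m <= M)%N ->
    lin_span iota v (iter_factor (\sum_i l i *~ a i) m).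
Proof.
elim: M => [|M [J [v vP]]].
  exists unit, (fun=> 1) => m a; rewrite leqn0 => /eqP->; exists (fun=> 1) => /=.
  by rewrite big_const card_unit /= addr0 mulr1 rmorph1.
exists (J + (J + 'I_r * J))%type, (fun s => match s with inl j => v j | inr s' =>
  match s' with inl j => D (v j) | inr ij => l ij.1 * v ij.2 end end) => m a.
rewrite leq_eqVlt ltnS => /orP[/eqP->|mM]; last exact/lin_span_inl/vP.
apply: lin_span_inr => /=; apply: lin_spanD.
  apply: lin_span_inl; have [c ->] := vP M a (leqnn M); exists c.
  by rewrite der_sum; apply: eq_bigr => j _; rewrite derZ.
apply: (@lin_span_inr _ _ _ (fun ij : 'I_r * J => l ij.1 * v ij.2)).
apply: lin_span_mul; last exact: vP.
exists (fun i => (a i)%:~R); apply: eq_bigr => i _.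
by rewrite rmorph_int mulrzl.
Qed.

End DerivationTheory.

(** Shifted by multiples of d, the coefficient blocks do not overlap. *)
Lemma blocks_eq0 (R : nzRingType) d n (c : nat -> {poly R}) :
  (forall i, (size (c i) <= d)%N) -> \sum_(i < n) c i * 'X^(i * d) = 0 ->
  forall i, (i < n)%N -> c i = 0.
Proof.
move=> szc c0 i0 i0n; apply/polyP => l; rewrite coef0.
have [ld|dl] := ltnP l d; last by rewrite nth_default // (leq_trans (szc _)).
have := congr1 (fun p : {poly R} => p`_(i0 * d + l)) c0; rewrite coef0 coef_sum.
rewrite (bigD1 (Ordinal i0n)) //= coefMXn ltnNge leq_addr /= addKn big1 ?addr0 // => i ii0.
rewrite coefMXn; case: ltnP => // id; rewrite nth_default // (leq_trans (szc _)) //.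
have : (i < i0)%N.
  rewrite ltn_neqAle; apply/andP; split; first by rewrite -val_eqE in ii0.
  rewrite leqNgt; apply/negP => i0i; have : (i0.+1 * d <= i * d)%N by rewrite leq_mul2r i0i orbT.
  by rewrite mulSn; lia.
move=> ii; have : (i.+1 * d <= i0 * d)%N by rewrite leq_mul2r ii orbT.
by rewrite mulSn; lia.
Qed.

Lemma poly_eq0_of_roots (R : idomainType) n (X : 'I_n -> R) (b : 'I_n -> R) :
  injective X -> (forall i, \sum_m b m * X i ^+ m = 0) -> forall m, b m = 0.
Proof.
move=> injX bX m; pose p := \poly_(i < n) (if insub i is Some j then b j else 0).
have pb (j : 'I_n) : p`_j = b j by rewrite coef_poly ltn_ord valK.
rewrite -pb; suff -> : p = 0 by rewrite coef0.
apply/eqP/negPn/negP => pn0.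
have : (size [seq X i | i <- enum 'I_n] < size p)%N.
  apply: max_poly_roots => //; last by rewrite map_inj_uniq // enum_uniq.
  apply/allP => _ /mapP[i _ ->]; rewrite /root (horner_coef_wide _ (size_poly _ _)).
  by apply/eqP; rewrite -[RHS](bX i); apply: eq_bigr => j _; rewrite pb.
by rewrite size_map size_enum_ord ltnNge size_poly.
Qed.

(** Coordinates in the basis y of F over K(x), with one denominator for all v_j. *)
Lemma common_denominator (K F : fieldType) (iota : {rmorphism K -> F}) x n
    (y : 'I_n.+1 -> F) (J : finType) (v : J -> F) :
  transcendental iota x -> rank_le iota x n.+1 -> ~ poly_dependent iota x y ->
  exists (q : {poly K}) (R : J -> 'I_n.+1 -> {poly K}), q != 0 /\
    forall j, ev iota x q * v j = \sum_h ev iota x (R j h) * y h.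
Proof.
move=> x_tr rk yind.
have /choice[q /choice[P qP]] : forall j, exists q (P : 'I_n.+1 -> {poly K}), q != 0 /\
    ev iota x q * v j = \sum_h ev iota x (P h) * y h.
  move=> j; pose f (k : 'I_n.+2) := if unlift ord_max k is Some i then y i else v j.
  have fw i : f (widen_ord (leqnSn n.+1) i) = y i.
    rewrite /f (_ : widen_ord _ i = lift ord_max i) ?liftK //.
    by apply: val_inj; rewrite /= /bump leqNgt ltn_ord.
  have fm : f ord_max = v j by rewrite /f unlift_none.
  have [p [i0 pi0]] := rk f; rewrite big_ord_recr /= fm.
  under eq_bigr => i _ do rewrite fw.
  move=> /eqP; rewrite addrC addr_eq0 => /eqP pE.
  exists (p ord_max), (fun h => - p (widen_ord (leqnSn n.+1) h)); split; last first.
    by rewrite pE -sumrN; apply: eq_bigr => i _; rewrite rmorphN mulNr.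
  apply/eqP => pm0; apply: yind; exists (fun h => p (widen_ord (leqnSn n.+1) h)).
    case: (unliftP ord_max i0) pi0 => [i ->|->]; last by rewrite pm0 eqxx.
    exists i; rewrite (_ : widen_ord _ _ = lift ord_max i) //.
    by apply: val_inj; rewrite /= /bump leqNgt ltn_ord.
  by apply/eqP; rewrite -oppr_eq0 -pE pm0 rmorph0 mul0r.
exists (\prod_j q j), (fun j h => \prod_(j' | j' != j) q j' * P j h); split.
  by apply/prodf_neq0 => j _; have [] := qP j.
move=> j; rewrite (bigD1 j) //= rmorphM mulrAC (qP j).2 mulrC mulr_sumr.
by apply: eq_bigr => h _; rewrite rmorphM mulrA.
Qed.

Lemma not_sum_of_S_units_char0 (K F : fieldType) (iota : {rmorphism K -> F})
    (S : set (set F)) N :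
  (forall n, n.+1%:R != 0 :> F) ->
  function_field iota -> finite_set S -> S !=set0 -> (forall P, S P -> is_place iota P) ->
  exists2 s, S_integral iota S s & forall k (e : 'I_k -> F), (k <= N)%N ->
    (forall i, S_unit iota S (e i)) -> s <> \sum_i e i.
Proof.
move=> char0 FK finS Sne Sp.
have [x [v0 [Sx x_tr _ _]]] := nonconstant_S_integer FK Sne Sp.
have [D [derD Dx]] := derivation_exists char0 FK x_tr.
have [r [g [Ug gU]]] := S_unit_generators FK finS Sp.
have [n [rk [y yind]]] := exact_rank FK x_tr.
(* Each unit imposes [F : K(x)] = n + 1 linear conditions over K[x], so N units impose at most M,
   one fewer than there are coefficients b_0, ..., b_M. *)
pose M := (N * n.+1)%N.
pose l (i : 'I_r) := D (g i) / g i.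
have [J [v vspan]] := iter_factor_span derD l M.
have [Q [R [Qn0 QR]]] := common_denominator v x_tr rk yind.
pose d0 := \max_j \max_h size (R j h).
have szR j h : (size (R j h) <= d0)%N.
  by apply: leq_trans (leq_bigmax j); apply: (leq_bigmax h).
(* With d > M d0, the (M + 1) d unknown coefficients of the b_m outnumber the at most M (d + d0)
   equations over K. *)
pose d := (M * d0).+1.
exists (\sum_(i < M.+1) x ^+ (i * d)).
  apply: (subring_sum (S_integral_is_subring iota S)) => i _.
  exact: (subringX (S_integral_is_subring iota S)).
move=> k u kN uU sE.
have /choice[lam /choice[a lamP]] : forall j, exists lam (a : 'I_r -> int),
    lam = \sum_i l i *~ a i /\ D (u j) = u j * lam.
  move=> j; have [a [c [c_alg cn0 uE]]] := gU _ (uU j).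
  exists (\sum_i l i *~ a i), (fun i => a i); split => //.
  rewrite uE (derM derD) (der_algebraic char0 derD c_alg) mul0r addr0.
  by rewrite (logder_prod derD) ?mulrA // => i ir; have [] := Ug i ir.
have /choice[A AP] : forall jm : 'I_k * 'I_M.+1, exists A : 'I_n.+1 -> {poly K},
    (forall h, (size (A h) <= d0)%N) /\
    ev iota x Q * iter_factor D (lam jm.1) jm.2 = \sum_h ev iota x (A h) * y h.
  move=> [j m] /=; have [c cE] := vspan m (a j) (ltn_ord m).
  rewrite (lamP j).1 cE; exists (fun h => \sum_t c t *: R t h); split.
    move=> h; apply: (leq_trans (size_sum _ _ _)); apply/bigmax_leqP => t _.
    exact: leq_trans (size_scale_leq _ _) (szR t h).
  rewrite mulr_sumr; under [LHS]eq_bigr => t _ do rewrite mulrCA QR mulr_sumr.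
  rewrite exchange_big; apply: eq_bigr => h _ /=; rewrite rmorph_sum mulr_suml.
  by apply: eq_bigr => t _; rewrite -mul_polyC rmorphM /= evC mulrA.
have [|beta [[m0 i0] beta0] betaP] := @lin_dep _ _ _
    (fun (mi : 'I_M.+1 * 'I_d) (jhl : 'I_k * 'I_n.+1 * 'I_(d + d0)) =>
      (A (jhl.1.1, mi.1) jhl.1.2 * 'X^(mi.2))`_(jhl.2)).
  rewrite !card_prod !card_ord.
  have kM : (k * n.+1 <= M)%N by rewrite leq_mul2r kN orbT.
  apply: (@leq_ltn_trans (M * (d + d0))); first by rewrite leq_mul2r kM orbT.
  by rewrite /d; nia.
pose b m := \sum_(i < d) beta (m, i) *: 'X^i.
have szb m : (size (b m) <= d)%N.
  apply: (leq_trans (size_sum _ _ _)); apply/bigmax_leqP => i _.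
  by apply: leq_trans (size_scale_leq _ _) _; rewrite size_polyXn.
have bA j h : \sum_m b m * A (j, m) h = 0.
  have -> : \sum_m b m * A (j, m) h = \sum_m \sum_i beta (m, i) *: (A (j, m) h * 'X^i).
    apply: eq_bigr => m _; rewrite mulr_suml; apply: eq_bigr => i _.
    by rewrite -scalerAl mulrC.
  apply/polyP => t; rewrite coef0 pair_bigA coef_sum /=.
  have [td|dt] := ltnP t (d + d0).
    rewrite -[RHS](betaP (j, h, Ordinal td)); apply: eq_bigr => -[m i] _ /=.
    by rewrite coefZ.
  rewrite big1 // => -[m i] _ /=; rewrite coefZ nth_default ?mulr0 //.
  apply: leq_trans (size_polyMleq _ _) _; rewrite size_polyXn addnS /=.
  have [szA _] := AP (j, m); apply: leq_trans dt.
  by rewrite addnC (leq_add (ltnW (ltn_ord i)) (szA h)).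
have bD j : \sum_m ev iota x (b m) * iter_factor D (lam j) m = 0.
  have Qx : ev iota x Q != 0 by rewrite ev_eq0.
  apply: (mulfI Qx); rewrite mulr0 mulr_sumr.
  under eq_bigr => m _ do rewrite mulrCA (AP (j, m)).2 mulr_sumr.
  rewrite exchange_big big1 //= => h _.
  transitivity (ev iota x (\sum_m b m * A (j, m) h) * y h); last by rewrite bA rmorph0 mul0r.
  by rewrite rmorph_sum mulr_suml; apply: eq_bigr => m _; rewrite rmorphM mulrA.
have bs : \sum_m ev iota x (b m) * iter m D (\sum_(i < M.+1) x ^+ (i * d)) = 0.
  rewrite sE; under eq_bigr => m _.
    rewrite (iter_der_sum derD) mulr_sumr.
    under eq_bigr => j _ do rewrite (iter_der_factor derD _ (lamP j).2) mulrCA.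
    over.
  by rewrite exchange_big big1 //= => j _; rewrite -mulr_sumr bD mulr0.
(* The operator sends x^(i d) to c_i(x) x^(i d) with c_i of degree below d, so the blocks separate
   and every c_i vanishes. *)
pose c i := \sum_(m < M.+1) ((i * d)%:R ^+ m) *: b m.
have c0 : \sum_(i < M.+1) c i * 'X^(i * d) = 0.
  apply/eqP; rewrite -(ev_eq0 _ x_tr) -[X in _ == X]bs rmorph_sum /=; apply/eqP.
  under [RHS]eq_bigr => m _ do rewrite (iter_der_sum derD) mulr_sumr.
  rewrite [RHS]exchange_big; apply: eq_bigr => i _ /=.
  rewrite rmorphM /= evXn rmorph_sum mulr_suml; apply: eq_bigr => m _.
  rewrite (iter_der_power derD _ _ Dx) -mul_polyC rmorphM /= evC rmorphXn rmorph_nat.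
  by rewrite mulrA [ev _ _ _ * _]mulrC.
have szc i : (size (c i) <= d)%N.
  apply: (leq_trans (size_sum _ _ _)); apply/bigmax_leqP => m _.
  exact: leq_trans (size_scale_leq _ _) (szb m).
have ci0 := blocks_eq0 szc c0.
have injX : injective (fun i : 'I_M.+1 => (i * d)%:R : K).
  move=> i j; wlog ij : i j / (i <= j)%N.
    by move=> wl e; case: (leqP i j) => [|/ltnW] h; [|apply/esym]; apply: wl.
  move=> e; apply: val_inj => /=; apply/eqP; rewrite eqn_leq ij /= leqNgt; apply/negP => lij.
  have : (j * d - i * d)%:R = 0 :> K by rewrite natrB ?leq_mul2r ?ij ?orbT // e subrr.
  have : (0 < j * d - i * d)%N by rewrite -mulnBl muln_gt0 subn_gt0 lij.
  case: (j * d - i * d)%N => // t _ /eqP; rewrite -(fmorph_eq0 iota) rmorph_nat.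
  by rewrite (negPf (char0 t)).
(* The i0-th coefficients of the b_m are those of a polynomial of degree at most M that vanishes at
   the M + 1 distinct elements i d of K. *)
have bm0 m : (b m)`_i0 = 0.
  apply: (poly_eq0_of_roots (b := fun m => (b m)`_i0) injX) => i.
  have := congr1 (fun p : {poly K} => p`_i0) (ci0 i (ltn_ord i)); rewrite coef0 coef_sum => e.
  by rewrite -[RHS]e; apply: eq_bigr => m' _; rewrite coefZ mulrC.
have := bm0 m0; rewrite coef_sum (bigD1 i0) //= coefZ coefXn eqxx mulr1 big1 ?addr0.
  by move=> e; rewrite e eqxx in beta0.
by move=> i ii0; rewrite coefZ coefXn val_eqE eq_sym (negPf ii0) mulr0.
Qed.

(** * The theorem *)

Lemma not_sum_of_S_units (K F : fieldType) (iota : {rmorphism K -> F})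
    (S : set (set F)) N :
  perfect_field K -> function_field iota -> finite_set S -> S !=set0 ->
  (forall P, S P -> is_place iota P) ->
  exists2 s, S_integral iota S s & forall k (e : 'I_k -> F), (k <= N)%N ->
    (forall i, S_unit iota S (e i)) -> s <> \sum_i e i.
Proof.
move=> perfK FK finS Sne Sp.
have [char0|/existsNP[n /negP/negPn n0]] := pselect (forall n, n.+1%:R != 0 :> F).
  exact: not_sum_of_S_units_char0.
have [p charF] := natf0_pchar (ltn0Sn n) n0.
exact: (not_sum_of_S_units_charp charF).
Qed.

Lemma S_unit_val (K F : fieldType) (iota : {rmorphism K -> F}) (S : set (set F))
    (u : S_integers iota S) : u \is a GRing.unit -> S_unit iota S (\val u).
Proof.
move=> /mulVr uV; have uV' : \val u^-1 * \val u = 1 by rewrite -rmorphM uV rmorph1.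
have un0 : \val u != 0.
  by apply/eqP => u0; move/eqP: uV'; rewrite u0 mulr0 eq_sym oner_eq0.
split=> //; first exact/asboolP/(valP u).
have -> : (\val u)^-1 = \val u^-1 by rewrite -[LHS]mul1r -uV' mulfK.
exact/asboolP/(valP u^-1).
Qed.

Theorem theorem1 (K F : fieldType) (iota : {rmorphism K -> F})
    (perfectK : perfect_field K) (FK : function_field iota)
    (S : set (set F)) (finS : finite_set S) (S_neq0 : S !=set0)
    (S_places : forall P, S P -> is_place iota P) :
  (forall N : nat, (0 < N)%N ->
     exists x : S_integers iota S,
       ~ (exists k : nat, (k <= N)%N /\ good_elt k x)) /\
  usn_le Omega (unit_sum_number (S_integers iota S)).
Proof.
have main N : exists x : S_integers iota S,
    ~ (exists k : nat, (k <= N)%N /\ good_elt k x).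
  have [s Ss sN] := not_sum_of_S_units N perfectK FK finS S_neq0 S_places.
  have sP : s \in S_integral_pred iota S by apply/asboolP.
  exists (SInteger sP) => -[k [kN [e eU /(congr1 \val) /= sE]]].
  apply: (sN k (fun i => \val (e i)) kN) => [i|]; first exact/S_unit_val/eU.
  pose vr : {rmorphism S_integers iota S -> F} := (\val : S_integers iota S -> F).
  by rewrite sE -[LHS]/(vr _) rmorph_sum.
split=> [N _|]; first exact: main.
rewrite /unit_sum_number; case: pselect => [exk|_]; last by case: ifP.
have [k /andP[_ /asboolP good]] := exk; have [x []] := main k.
by exists k.
Qed.
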